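(* There exists $\epsilon=\epsilon(q)>0$ such that, when COL is run with this $\epsilon$, with high probability on completion of COL every vertex $v\in LARGE$ satisfies $d_c^*(v)\ge\frac{\epsilon\log n}{1000q}$ for all $c\in[q]$.
   Context: Fix an integer $q\ge 4$. Let $\omega=\omega(n)\to\infty$ with $\omega=o(\log\log n)$, $p=\frac{\log n+(q-1)\log\log n-\omega}{n}$, $m=\binom n2 p$. The random graph process on $[n]$: $G_0$ is empty and $G_t=G_{t-1}+e_t$ where $e_t$ is uniform among pairs not in $G_{t-1}$; $\tau_q$ is the first $t$ with $\delta(G_t)\ge q$. $LARGE$ is the set of vertices with degree at least $\frac{\log n}{100q}$ in $G_m$. Let $t_\epsilon=\epsilon n\log n$. Algorithm COL colors, for $t=1,2,\ldots,\tau_q$, the edge $e_t$ on arrival with a color in $[q]$ and places it into one of the sets $E_c^*$ or $E_c^+$ ($c$ its color). $d_c(v)$ is the current number of edges at $v$ of color $c$; $C_v^{(t)}=\{c\in[q]: v$ has no incident edge of color $c$ at time $t\}$. $Full$ is the set of vertices having at least $\frac{\epsilon\log n}{1000q}$ incident edges of every color among $e_1,\ldots,e_{t_\epsilon}$. With $e_t=uv$: (Step 2) if $C_u^{(t)}\cup C_v^{(t)}=\emptyset$, $t>t_\epsilon$ and exactly one of $u,v$, say $u$, is in $Full$, give $uv$ a color $c$ minimizing $d_c(v)$ (ties arbitrary), add to $E_c^*$; (Step 3) if $C_u^{(t)}\cup C_v^{(t)}=\emptyset$, $t>t_\epsilon$ and both $u,v\in Full$, give a uniformly random color $c\in[q]$,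 add to $E_c^+$ or $E_c^*$ each with probability $1/2$; (Step 4) if $C_u^{(t)}\cup C_v^{(t)}=\emptyset$ but $t\le t_\epsilon$ or both $u,v\notin Full$, give a uniformly random color $c\in[q]$, add to $E_c^*$; (Step 5) otherwise give a color $c$ uniformly random from $C_u^{(t)}\cup C_v^{(t)}$, add to $E_c^*$. All random choices are independent of each other and of the process. $d_c^*(v)$ denotes the number of edges incident with $v$ that COL colors $c$, excluding edges colored in Step 3. *)

(* Defs.v *)
From mathcomp Require Import all_boot all_order all_algebra.
From mathcomp Require Import all_classical all_reals all_analysis.

Set Implicit Arguments.
Unset Strict Implicit.
Unset Printing Implicit Defensive.

Import Order.TTheory GRing.Theory Num.Theory.
Local Open Scope ring_scope.

(* One arrival: the edge e_t, together with [Some (c, true)] if COL puts it in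
   E_c^*, [Some (c, false)] if COL puts it in E_c^+, and [None] if it arrives
   after tau_q and hence is not colored. *)
Definition arrival (n q : nat) : finType :=
  ({set 'I_n} * option ('I_q * bool))%type.

(* The first t arrivals, in order. *)
Definition history (n q : nat) := seq (arrival n q).

(* How Step 2 breaks ties: from the past h, the new edge e and its endpoint v
   outside Full, choose a color.  [valid_ties] says that it is always one
   minimizing d_c(v). *)
Definition tie_rule (q : nat) :=
  forall n, history n q -> {set 'I_n} -> 'I_n -> 'I_q.

Inductive col_step := Step2 | Step3 | Step4 | Step5.

Definition is_step3 (s : col_step) := if s is Step3 then true else false.

Section Graph.
Variables n q : nat.
Implicit Types (h : history n q) (v : 'I_n) (c : 'I_q) (e : {set 'I_n}).

Definition pairs : {set {set 'I_n}} := [set e : {set 'I_n} | #|e| == 2].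

Definition deg h v : nat := count (fun x : arrival n q => v \in x.1) h.

Definition has_color c (x : arrival n q) : bool := omap fst x.2 == Some c.

Definition cdeg h c v : nat :=
  count (fun x : arrival n q => (v \in x.1) && has_color c x) h.

(* The first t <= size h with delta(G_t) >= q, and (size h).+1 if there is
   none, i.e. if tau_q lies beyond h. *)
Definition tau h : nat :=
  find (fun t => [forall v, q <= deg (take t h) v]%N) (iota 0 (size h).+1).

(* C_u \cup C_v for e = uv. *)
Definition missing h e : {set 'I_q} :=
  [set c | [exists v in e, cdeg h c v == 0%N]].

Definition fresh h : {set {set 'I_n}} :=
  pairs :\: [set e | e \in [seq x.1 | x : arrival n q <- h]].

End Graph.

Definition valid_ties (q : nat) (sel : tie_rule q) : Prop :=
  forall n (h : history n q) (e : {set 'I_n}) (v : 'I_n) (c : 'I_q),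
    (cdeg h (sel n h e v) v <= cdeg h c v)%N.

Section COL.
Variables (R : realType) (q : nat) (eps : R) (sel : tie_rule q) (n : nat).
Implicit Types (h : history n q) (v : 'I_n) (c : 'I_q) (e : {set 'I_n}).

(* Real-valued times and edge counts are rounded down. *)
Definition t_eps : nat := Num.truncn (eps * n%:R * ln n%:R).

Definition threshold : R := eps * ln n%:R / (1000 * q%:R).

Definition Full h : {set 'I_n} :=
  [set v | [forall c, threshold <= (cdeg (take t_eps h) c v)%:R]].

(* The step of COL that handles e, arriving at time t = (size h).+1. *)
Definition step_of h e : col_step :=
  if missing h e != finset.set0 then Step5
  else if (size h < t_eps)%N then Step4
  else if #|e :&: Full h| == 1%N then Step2
  else if #|e :&: Full h| == 2 then Step3
  else Step4.

(* Conditional law, given the past h and the new edge e, of the color and class of e.  In Step 2,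
   e :\: Full h is the singleton of the endpoint outside Full. *)
Definition color_law h e (l : option ('I_q * bool)) : R :=
  if (tau h <= size h)%N then (l == None)%:R
  else if l is Some (c, star) then
    match step_of h e with
    | Step2 => (star && [exists v in e :\: Full h, c == sel h e v])%:R
    | Step3 => q%:R^-1 * 2^-1
    | Step4 => star%:R / q%:R
    | Step5 => (star && (c \in missing h e))%:R / #|missing h e|%:R
    end
  else 0.

(* Conditional law, given h, of the next arrival. *)
Definition arrival_law h (x : arrival n q) : R :=
  (x.1 \in fresh h)%:R / #|fresh h|%:R * color_law h x.1 x.2.

(* The process runs until all pairs have arrived (COL being idle after tau_q),
   since the degrees in G_m have to be defined also when tau_q < m. *)
Definition outcome := ('C(n, 2)).-tuple (arrival n q).

Definition weight (w : outcome) : R :=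
  \prod_(i < 'C(n, 2)) arrival_law (take i w) (tnth w i).

Definition Pr (A : pred outcome) : R := \sum_(w | A w) weight w.

(* d_c^*(v) on completion of COL. *)
Definition dstar (w : outcome) c v : nat :=
  #|[set i : 'I_('C(n, 2)) | [&& v \in (tnth w i).1, has_color c (tnth w i)
      & ~~ is_step3 (step_of (take i w) (tnth w i).1)]]|.

(* om stands for omega(n). *)
Definition edge_prob (om : R) : R :=
  (ln n%:R + (q%:R - 1) * ln (ln n%:R) - om) / n%:R.

Definition m_edges (om : R) : nat :=
  Num.truncn ('C(n, 2)%:R * edge_prob om).

Definition LARGE (om : R) (w : outcome) : {set 'I_n} :=
  [set v | (ln n%:R / (100 * q%:R) : R) <= (deg (take (m_edges om) w) v)%:R].

Definition large_ok (om : R) (w : outcome) : bool :=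
  [forall v in LARGE om w, forall c, threshold <= (dstar w c v)%:R].

End COL.

(* Main.v *)
(* A union bound over five rare events, each controlled by a nonnegative
   supermartingale on histories: by Markov, P(F >= 1) <= F(empty history).

   Write L = ln n, T1 = t_eps and let T2 be slightly less than n L / 2.  With high probability
   (1) no vertex meets L / (400 q) edges before T1, or between T2 and m, or, between
       T1 and m, L / (400 q) edges to non-Full vertices (exponential moments of the
       number of hits);
   (2) some vertex is isolated at T2, so tau_q > T2 (the potential is exp (- s_t X_t)
       with X_t the number of isolated vertices and s_t growing geometrically in t);
   (3) at most eps n vertices are not Full.  Each Step 5 edge shows one of its ends a
       new colour, so there are at most q n such edges up to tau_q and all but few
       vertices meet a bounded number of them; every other edge before T1 gets a
       uniform colour.
   Outside these events a vertex v of LARGE that is not Full has at least L / (400 q)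
   edges to Full vertices between T1 and T2.  Each of them gets a colour minimizing
   d_c(v), so \sum_c min (d_c(v), k) grows by one at each until it reaches q k; and
   v meets no Step 3 edge at all. *)
Require Import Defs.
From mathcomp Require Import all_boot all_order all_algebra.
From mathcomp Require Import all_classical all_reals all_analysis.
From mathcomp Require Import zify ring lra.
Import Order.TTheory GRing.Theory Num.Theory numFieldNormedType.Exports.

Set Implicit Arguments.
Unset Strict Implicit.
Unset Printing Implicit Defensive.

Local Open Scope ring_scope.

(** * Sums along a history of functions of the past and the next arrival *)

Section AdaptedSums.
Variable X : finType.
Implicit Types (h p : seq X) (x : X).

(* [tally B h] is the sum over i < size h of B (take i h) h_i. *)
Fixpoint tally_from (B : seq X -> X -> nat) p h : nat :=
  if h is x :: h' then (B p x + tally_from B (rcons p x) h')%N else 0%N.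

Definition tally B h := tally_from B [::] h.

Lemma tally_from_rcons B p h x :
  tally_from B p (rcons h x) = (tally_from B p h + B (p ++ h) x)%N.
Proof.
elim: h p => [|y h IHh] p /=; first by rewrite cats0 addn0.
by rewrite IHh cat_rcons addnA.
Qed.

Lemma tally_rcons B h x : tally B (rcons h x) = (tally B h + B h x)%N.
Proof. exact: tally_from_rcons. Qed.

(** Moving the truncation into the summand lets tallies over different prefixes be compared term by
    term along one history. *)
Lemma tally_take B b h :
  tally B (take b h) = tally (fun p x => if (size p < b)%N then B p x else 0%N) h.
Proof.
elim/last_ind: h => [|h x IHh]; first by [].
rewrite tally_rcons; case: ltnP => hb.
  rewrite [take b h]take_oversize 1?ltnW // in IHh.
  by rewrite take_oversize ?size_rcons // tally_rcons IHh.
by rewrite -cats1 takel_cat // IHh addn0.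
Qed.

(** The hypothesis is restricted to actual splittings of [h], so that properties of the whole
    history are available when its arrivals are compared. *)
Lemma leq_tally B B' h :
  (forall p x s, h = p ++ x :: s -> (B p x <= B' p x)%N) -> (tally B h <= tally B' h)%N.
Proof.
elim/last_ind: h => // h x IHh BB'; rewrite !tally_rcons leq_add //.
  by apply: IHh => p y s hE; apply: (BB' p y (rcons s x)); rewrite hE rcons_cat.
by apply: (BB' h x [::]); rewrite cats1.
Qed.

Lemma tallyD B B' h :
  tally (fun p x => (B p x + B' p x)%N) h = (tally B h + tally B' h)%N.
Proof.
elim/last_ind: h => // h x IHh; by rewrite !tally_rcons IHh addnACA.
Qed.

Lemma tally_from_tuple B t p (w : t.-tuple X) :
  (\sum_(i < t) B (p ++ take i w) (tnth w i))%N = tally_from B p w.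
Proof.
elim: t p w => [|t IHt] p w; first by rewrite tuple0 big_ord0.
case/tupleP: w => x w; rewrite big_ord_recl /= cats0 tnth0 -IHt.
congr (_ + _)%N; apply: eq_bigr => i _.
by rewrite /= tnthS cat_rcons.
Qed.

Lemma tally_tuple B t (w : t.-tuple X) :
  (\sum_(i < t) B (take i w) (tnth w i))%N = tally B w.
Proof. exact: (tally_from_tuple B [::] w). Qed.

Lemma count_tally (a : pred X) h : count a h = tally (fun _ x => nat_of_bool (a x)) h.
Proof.
elim/last_ind: h => // h x IHh.
by rewrite tally_rcons -IHh -cats1 count_cat /= addn0.
Qed.

End AdaptedSums.

(** * Supermartingales on histories *)

Section Potential.
Variables (R : realType) (X : finType) (N : nat) (law : seq X -> X -> R).
Hypothesis law_ge0 : forall h x, 0 <= law h x.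
Hypothesis law_sum : forall h, (size h < N)%N -> \sum_x law h x = 1.

(** The starting history [h0] is kept general because the induction peels off the first of the
    remaining arrivals and appends it to [h0]. *)
Lemma sum_potential_from (F : seq X -> R) t h0 : (size h0 + t <= N)%N ->
  (forall h, (size h < N)%N -> \sum_x law h x * F (rcons h x) <= F h) ->
  \sum_(w : t.-tuple X)
    (\prod_(i < t) law (h0 ++ take i w) (tnth w i)) * F (h0 ++ w) <= F h0.
Proof.
move=> + HF; elim: t h0 => [|t IHt] h0 ht.
  rewrite (big_pred1 [tuple]); first by rewrite big_ord0 mul1r cats0.
  by move=> w; apply/esym/eqP; rewrite [w]tuple0.
have h0N : (size h0 < N)%N by apply: leq_trans ht; rewrite addnS ltnS leq_addr.
apply: le_trans (HF _ h0N).
rewrite (reindex (fun p : X * t.-tuple X => [tuple of p.1 :: p.2])) /=; last first.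
  exists (fun w => (thead w, [tuple of behead w])) => w _.
    by case: w => x w /=; rewrite theadE; congr pair; apply/val_inj.
  by rewrite /= -tuple_eta.
rewrite -(pair_bigA _ (fun (x : X) (w : t.-tuple X) =>
  (\prod_(i < t.+1) law (h0 ++ take i (x :: w)) (tnth [tuple of x :: w] i)) *
  F (h0 ++ x :: w))) /=.
apply: ler_sum => x _.
have := IHt (rcons h0 x); rewrite size_rcons addSnnS => /(_ ht).
move/(ler_wpM2l (law_ge0 h0 x)); rewrite mulr_sumr; apply: le_trans.
rewrite le_eqVlt; apply/orP; left; apply/eqP/eq_bigr => w _; rewrite big_ord_recl /= cats0 tnth0 -mulrA cat_rcons.
congr (_ * (_ * _)); apply: eq_bigr => i _.
by rewrite cat_rcons tnthS.
Qed.

Lemma sum_potential (F : seq X -> R) b : (b <= N)%N ->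
  (forall h, (size h < b)%N -> \sum_x law h x * F (rcons h x) <= F h) ->
  \sum_(w : N.-tuple X)
    (\prod_(i < N) law (take i w) (tnth w i)) * F (take b w) <= F [::].
Proof.
move=> bN HF.
(* The potential is stopped at time [b]; from then on it is constant and the law has total mass
   one. *)
have := @sum_potential_from (fun h => F (take b h)) N [::] (leqnn N).
apply=> h hN.
case: (ltnP (size h) b) => hb.
  rewrite [take b h]take_oversize 1?ltnW //.
  apply: le_trans (HF _ hb); apply: ler_sum => x _.
  by rewrite take_oversize // size_rcons.
rewrite (eq_bigr (fun x => law h x * F (take b h))); last first.
  by move=> x _; rewrite -cats1 takel_cat.
by rewrite -mulr_suml law_sum // mul1r.
Qed.

End Potential.

(** * The law of the next arrival, and probabilities of events *)

Section Arrivals.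
Variables (R : realType) (q : nat) (eps : R) (sel : tie_rule q) (n : nat).
Implicit Types (h : history n q) (v u : 'I_n) (c : 'I_q) (e : {set 'I_n}).

Local Notation N := 'C(n, 2).

Lemma card_pairs : #|pairs n| = N.
Proof. by rewrite card_draws card_ord. Qed.

Lemma card_fresh_ge h : (N - size h <= #|fresh h|)%N.
Proof.
rewrite -card_pairs /fresh cardsD leq_sub2l //.
apply: leq_trans (subset_leq_card (finset.subsetIr _ _)) _.
rewrite cardsE; apply: leq_trans (card_size _) _.
by rewrite size_map.
Qed.

Lemma card_fresh_le h : (#|fresh h| <= N)%N.
Proof. by rewrite -card_pairs subset_leq_card // finset.subsetDl. Qed.

Lemma fresh_gt0 h : (size h < N)%N -> (0 < #|fresh h|)%N.
Proof. by move=> hN; apply: leq_trans (card_fresh_ge h); rewrite subn_gt0. Qed.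

Lemma fresh_pair h e : e \in fresh h -> #|e| = 2.
Proof. by rewrite !inE => /andP[_ /eqP]. Qed.

Lemma color_law_ge0 h e l : 0 <= color_law eps sel h e l.
Proof.
rewrite /color_law; case: ifP => _; first exact: ler0n.
case: l => [[c b]|] //; case: step_of => //.
all: by rewrite ?mulr_ge0 ?divr_ge0 ?invr_ge0 ?ler0n.
Qed.

Lemma arrival_law_ge0 h x : 0 <= arrival_law eps sel h x.
Proof. by rewrite mulr_ge0 ?color_law_ge0 // divr_ge0 ?ler0n. Qed.

Lemma sum_labels (f : option ('I_q * bool) -> R) :
  \sum_l f l = f None + \sum_c (f (Some (c, true)) + f (Some (c, false))).
Proof.
rewrite (bigD1 None) //=; congr (_ + _).
rewrite (reindex_omap Some id) /=; last by case.
rewrite (eq_bigl xpredT); last by move=> x; rewrite eqxx.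
have -> : \sum_j f (Some j) = \sum_c \sum_b f (Some (c, b)).
  by rewrite pair_bigA; apply: eq_bigr => -[].
by apply: eq_bigr => c _; rewrite big_bool.
Qed.

Lemma color_law_sum h e : (0 < q)%N -> #|e| = 2 ->
  \sum_l color_law eps sel h e l = 1.
Proof.
move=> q0 e2; rewrite sum_labels /color_law; case: ifP => tl.
  by rewrite big1 ?addr0 ?eqxx // => c _; rewrite /= addr0.
rewrite add0r /step_of; case: ifPn => [m0|_].
  under eq_bigr do rewrite /= mul0r addr0.
  rewrite -mulr_suml -natr_sum.
  have -> : (\sum_c (c \in missing h e))%N = #|missing h e|.
    by rewrite -sum1_card [RHS]big_mkcond; apply: eq_bigr => c _; case: ifP.
  by rewrite divff // pnatr_eq0 cards_eq0.
case: ifP => _.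
  under eq_bigr do rewrite /= mul0r addr0.
  by rewrite sumr_const card_ord div1r -[LHS]mulr_natl divff // pnatr_eq0 -lt0n.
case: ifPn => [/eqP eF|_].
  (* In Step 2 only one endpoint lies outside [Full], so the law is a point mass at the colour [sel]
     picks there. *)
  have /eqP/cards1P[v ev] : #|e :\: Full eps h| = 1%N.
    by have := cardsID (Full eps h) e; rewrite e2 eF => -[].
  rewrite (bigD1 (sel h e v)) //= addr0 big1 ?addr0.
    by case: existsP => // -[]; exists v; rewrite ev inE !eqxx.
  move=> c cv /=; rewrite addr0; case: existsP => // -[u].
  by rewrite ev inE => /andP[/eqP-> /eqP cE]; rewrite cE eqxx in cv.
case: ifP => _.
  have qn0 : q%:R != 0 :> R by rewrite pnatr_eq0 -lt0n.
  by rewrite sumr_const card_ord -[LHS]mulr_natl; field.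
under eq_bigr do rewrite /= mul0r addr0.
by rewrite sumr_const card_ord div1r -[LHS]mulr_natl divff // pnatr_eq0 -lt0n.
Qed.

Lemma sum_arrival_law (G : arrival n q -> R) h :
  \sum_x arrival_law eps sel h x * G x =
  (\sum_(e in fresh h) \sum_l color_law eps sel h e l * G (e, l)) / #|fresh h|%:R.
Proof.
rewrite [RHS]mulrC mulr_sumr [RHS]big_mkcond /=.
transitivity (\sum_e \sum_l arrival_law eps sel h (e, l) * G (e, l)).
  by rewrite pair_bigA; apply: eq_bigr => -[].
apply: eq_bigr => e _; rewrite /arrival_law /=; case: ifP => _; last first.
  by rewrite big1 // => l _; rewrite !mul0r.
by rewrite mulr_sumr; apply: eq_bigr => l _; rewrite mul1r mulrA.
Qed.

Lemma arrival_law_sum h : (0 < q)%N -> (size h < N)%N ->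
  \sum_x arrival_law eps sel h x = 1.
Proof.
move=> q0 /fresh_gt0 f0.
under eq_bigr do rewrite -[arrival_law _ _ _ _]mulr1.
rewrite sum_arrival_law (eq_bigr (fun=> 1)) => [|e /fresh_pair e2].
  by rewrite sumr_const divff // pnatr_eq0 -lt0n.
by under eq_bigr do rewrite mulr1; exact: color_law_sum.
Qed.

Lemma sum_arrival_law_edge (g : {set 'I_n} -> R) h : (0 < q)%N ->
  \sum_x arrival_law eps sel h x * g x.1 = (\sum_(e in fresh h) g e) / #|fresh h|%:R.
Proof.
move=> q0; rewrite sum_arrival_law; congr (_ / _); apply: eq_bigr => e /fresh_pair e2.
by rewrite /= -mulr_suml color_law_sum // mul1r.
Qed.

(** These are the histories of positive probability; assertions about the choices made by COL hold
    only along them. *)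
Definition legal h := forall p x s, h = p ++ x :: s -> arrival_law eps sel p x != 0.

Lemma legal_rcons h x : legal (rcons h x) -> legal h /\ arrival_law eps sel h x != 0.
Proof.
move=> lh; split; last by apply: (lh _ _ [::]); rewrite cats1.
by move=> p y s hE; apply: (lh p y (rcons s x)); rewrite hE rcons_cat.
Qed.

Lemma legal_take b h : legal h -> legal (take b h).
Proof.
move=> lh p y s hE; apply: (lh p y (s ++ drop b h)).
by rewrite -[LHS](cat_take_drop b) hE -catA.
Qed.

Lemma legal_weight (w : outcome q n) : weight eps sel w != 0 -> legal w.
Proof.
move=> w0 p x s wE.
have szw : (size p < N)%N by rewrite -(size_tuple w) wE size_cat /= addnS ltnS leq_addr.
move: w0; rewrite /weight prodf_seq_neq0 => /allP /(_ (Ordinal szw)).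
rewrite mem_index_enum => /(_ isT) /=.
by rewrite (tnth_nth x) wE take_size_cat // nth_cat ltnn subnn.
Qed.

Lemma legal_edge h x : arrival_law eps sel h x != 0 -> x.1 \in fresh h.
Proof. by rewrite /arrival_law; case: (x.1 \in fresh h) => //; rewrite !mul0r eqxx. Qed.

Lemma legal_color h x : arrival_law eps sel h x != 0 -> color_law eps sel h x.1 x.2 != 0.
Proof. by rewrite /arrival_law mulf_eq0 negb_or => /andP[]. Qed.

(** Markov's inequality: [F] dominates the indicator of [A] on the support at time [b], and its mean
    is at most its initial value. *)
Lemma Pr_potential (F : history n q -> R) b (A : pred (outcome q n)) :
  (0 < q)%N -> (b <= N)%N -> (forall h, 0 <= F h) ->
  (forall h, (size h < b)%N ->
    \sum_x arrival_law eps sel h x * F (rcons h x) <= F h) ->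
  (forall w : outcome q n, legal w -> A w -> 1 <= F (take b w)) ->
  Pr eps sel A <= F [::].
Proof.
move=> q0 bN F0 HF AF.
have lge0 := arrival_law_ge0.
have lsum h : (size h < N)%N -> \sum_x arrival_law eps sel h x = 1 by exact: arrival_law_sum.
apply: le_trans (sum_potential lge0 lsum bN HF).
rewrite /Pr big_mkcond /=; apply: ler_sum => w _.
have w0 : 0 <= weight eps sel w by apply: prodr_ge0 => i _; exact: arrival_law_ge0.
rewrite -/(weight eps sel w); case: ifP => [Aw|_]; last exact: mulr_ge0.
have [->|wn0] := eqVneq (weight eps sel w) 0; first by rewrite mul0r.
by rewrite -[leLHS]mulr1 ler_wpM2l // AF //; exact: legal_weight.
Qed.

Lemma Pr_complement (A : pred (outcome q n)) : (0 < q)%N ->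
  Pr eps sel A = 1 - Pr eps sel (predC A).
Proof.
move=> q0.
have lge0 := arrival_law_ge0.
have lsum h : (size h < N)%N -> \sum_x arrival_law eps sel h x = 1 by exact: arrival_law_sum.
(* Constants of either sign are potentials; the values 1 and -1 bound the total mass from above and
   from below. *)
have tot (a : R) : (\sum_(w : outcome q n) weight eps sel w) * a <= a.
  rewrite mulr_suml.
  exact: (sum_potential (F := fun=> a) lge0 lsum (leq0n N)).
have : \sum_(w : outcome q n) weight eps sel w = 1.
  by apply/le_anti; have := tot 1; have := tot (-1); rewrite mulrN1 lerN2 mulr1 => -> ->.
by rewrite (bigID A) /= => <-; rewrite addrK.
Qed.

Lemma weight_ge0 (w : outcome q n) : 0 <= weight eps sel w.
Proof. by apply: prodr_ge0 => i _; exact: arrival_law_ge0. Qed.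

Lemma Pr_le (A B : pred (outcome q n)) :
  (forall w : outcome q n, legal w -> A w -> B w) -> Pr eps sel A <= Pr eps sel B.
Proof.
move=> AB; rewrite /Pr big_mkcond [leRHS]big_mkcond /=; apply: ler_sum => w _.
have [->|/legal_weight lw] := eqVneq (weight eps sel w) 0; first by do 2 case: ifP.
by case: ifP => [/(AB _ lw) -> //|_]; case: ifP => // _; exact: weight_ge0.
Qed.

Lemma Pr_union (A B : pred (outcome q n)) :
  Pr eps sel (predU A B) <= Pr eps sel A + Pr eps sel B.
Proof.
rewrite /Pr big_mkcond [X in _ <= X + _]big_mkcond [X in _ <= _ + X]big_mkcond.
rewrite -big_split /=; apply: ler_sum => w _; have w0 := weight_ge0 w.
by rewrite /predU /=; case: (A w) => /=; case: (B w); rewrite ?addr0 ?add0r // lerDl.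
Qed.

End Arrivals.

(** * Counting the edges at a vertex *)

Section Edges.
Variables (q n : nat).
Implicit Types (h : history n q) (v u : 'I_n) (e : {set 'I_n}) (A : {set 'I_n}).

Definition joins A v e := (v \in e) && [exists u in A, (u != v) && (u \in e)].

Lemma pairE e v u : #|e| = 2 -> v \in e -> u \in e -> u != v -> e = [set v; u].
Proof.
move=> e2 ve ue uv; apply/esym/eqP; rewrite eqEcard cards2 eq_sym uv e2 andbT.
by apply/fintype.subsetP => x; rewrite !inE => /orP[] /eqP->.
Qed.

Lemma card_joins A v : (#|[set e in pairs n | joins A v e]| <= #|A|)%N.
Proof.
apply: leq_trans (leq_imset_card (fun u => [set v; u]) A).
apply: subset_leq_card; apply/fintype.subsetP => e; rewrite !inE.
case/andP=> /eqP e2 /andP[ve /existsP[u /and3P[uA uv ue]]].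
by apply/imsetP; exists u => //; exact: pairE.
Qed.

Lemma card_star v : #|[set e in pairs n | v \in e]| = n.-1.
Proof.
have -> : n.-1 = #|[set~ v]| by rewrite cardsC1 card_ord.
rewrite -(@card_in_imset _ _ (fun u => [set v; u]) [set~ v]); last first.
  move=> u u'; rewrite !inE => uv u'v /setP/(_ u).
  by rewrite !inE eqxx orbT (negPf uv) => /esym/eqP.
apply: eq_card => e; rewrite !inE; apply/andP/imsetP => [[/eqP e2 ve]|[u]].
  have /card_gt0P[u] : (0 < #|e :\ v|)%N.
    by have := cardsD1 v e; rewrite e2 ve /= add1n => -[<-].
  by rewrite !inE => /andP[uv ue]; exists u; rewrite ?inE //; exact: pairE.
rewrite !inE eq_sym => vu ->; by rewrite cards2 vu !inE !eqxx.
Qed.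

Lemma joinsT e v : #|e| = 2 -> joins [set: 'I_n] v e = (v \in e).
Proof.
move=> e2; rewrite /joins; case: (boolP (v \in e)) => //= ve.
have /card_gt0P[u] : (0 < #|e :\ v|)%N.
  by have := cardsD1 v e; rewrite e2 ve /= add1n => -[<-].
by rewrite !inE => ue; apply/existsP; exists u; rewrite inE.
Qed.

Lemma deg_rcons h x v : deg (rcons h x) v = (deg h v + (v \in x.1))%N.
Proof. by rewrite /deg -cats1 count_cat /= addn0. Qed.

Lemma cdeg_rcons h x c v :
  cdeg (rcons h x) c v = (cdeg h c v + ((v \in x.1) && has_color c x))%N.
Proof. by rewrite /cdeg -cats1 count_cat /= addn0. Qed.

(** Of the n - 1 pairs at [v], at most [deg h v] have already arrived. *)
Lemma card_fresh_star h v : (n.-1 - deg h v <= #|[set e in fresh h | v \in e]|)%N.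
Proof.
rewrite leq_subLR -(card_star v).
pose S := [set e : {set 'I_n} | (e \in [seq x.1 | x : arrival n q <- h]) && (v \in e)].
have SU : [set e in pairs n | v \in e] \subset S :|: [set e in fresh h | v \in e].
  apply/fintype.subsetP => e; rewrite !inE; case/andP=> -> ->.
  by rewrite !andbT orbN.
apply: leq_trans (subset_leq_card SU) _; apply: leq_trans (leq_card_setU _ _) _.
rewrite leq_add2r /deg.
rewrite -(count_map (fun x : arrival n q => x.1) (fun e : {set 'I_n} => v \in e)) -size_filter.
apply: leq_trans (card_size _); apply: subset_leq_card.
by apply/fintype.subsetP => e; rewrite !inE mem_filter andbC.
Qed.

End Edges.

(** * Exponential moments of the number of hits in a time window *)

Section Windows.
Variables (R : realType) (q : nat) (eps : R) (sel : tie_rule q) (n : nat).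
Hypothesis q_gt0 : (0 < q)%N.
Implicit Types (h : history n q) (v u : 'I_n) (c : 'I_q) (e : {set 'I_n}).

Local Notation N := 'C(n, 2).

Lemma sum_fresh_if (P : pred {set 'I_n}) (c : R) h : (size h < N)%N ->
  (\sum_(e in fresh h) (if P e then c else 1)) / #|fresh h|%:R =
  1 + (c - 1) * #|[set e in fresh h | P e]|%:R / #|fresh h|%:R.
Proof.
move=> /fresh_gt0 f0; have fn0 : #|fresh h|%:R != 0 :> R by rewrite pnatr_eq0 -lt0n.
rewrite (bigID P) /=.
under eq_bigr => e /andP[_ ->] do [].
under [X in _ + X]eq_bigr => e /andP[_ /negPf->] do [].
rewrite !sumr_const.
have -> : #|[pred e in fresh h | P e]| = #|[set e in fresh h | P e]|.
  by apply: eq_card => e; rewrite !inE.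
have <- : #|[set e in fresh h | ~~ P e]| = #|[pred e in fresh h | ~~ P e]|.
  by apply: eq_card => e; rewrite !inE.
have fE : #|fresh h|%:R = #|[set e in fresh h | P e]|%:R + #|[set e in fresh h | ~~ P e]|%:R :> R.
  rewrite -natrD; congr _%:R; rewrite -(cardsID [set e | P e] (fresh h)); congr (_ + _)%N.
    by apply: eq_card => e; rewrite !inE.
  by apply: eq_card => e; rewrite !inE andbC.
transitivity ((#|fresh h|%:R + (c - 1) * #|[set e in fresh h | P e]|%:R) / #|fresh h|%:R : R).
  by congr (_ / _); rewrite fE -[c *+ _]mulr_natr; ring.
by rewrite mulrDl divff //.
Qed.

Definition crowded (A : history n q -> {set 'I_n}) a b (k : R) (w : outcome q n) :=
  [exists v, k <=
    (tally (fun h x => (a <= size h)%N && joins (A h) v x.1 : nat) (take b w))%:R].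

(** Given the past, an arrival in the window joins [v] to [A h] with probability at most
    [beta / (N - b)], so it multiplies the moment of order [s] by at most 1 + z <= exp z, with [z]
    as set below. *)
Lemma Pr_window (A : history n q -> {set 'I_n}) (a b : nat) (s k beta : R) :
  0 <= s -> 0 <= beta -> (b < N)%N -> (forall h, #|A h|%:R <= beta) ->
  Pr eps sel (crowded A a b k) <= n%:R * expR (- s * k + (expR s - 1) * (beta / (N - b)%:R) * (b - a)%:R).
Proof.
move=> s0 beta0 bN AB.
set cnt := fun v h => tally (fun h x => (a <= size h)%N && joins (A h) v x.1 : nat) h.
set z := (expR s - 1) * (beta / (N - b)%:R).
have es : 0 <= expR s - 1 by rewrite subr_ge0 -expR0 ler_expR.
(* The last term prepays the growth over the rest of the window; the maximum keeps it constant
   before time [a]. *)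
pose f v h := expR (s * (cnt v h)%:R - s * k + z * (b - maxn a (size h))%:R).
have z0 : 0 <= z by rewrite !mulr_ge0 // invr_ge0.
have -> : n%:R * expR (- s * k + z * (b - a)%:R) = \sum_v f v [::].
  rewrite (eq_bigr (fun=> expR (- s * k + z * (b - a)%:R))) => [|v _].
    by rewrite sumr_const card_ord mulr_natl.
  by rewrite /f maxn0 /cnt /tally /= mulr0 add0r mulNr.
apply: (Pr_potential (F := fun h => \sum_v f v h) (b := b)) => //.
- exact: ltnW.
- by move=> h; apply: sumr_ge0 => v _; exact: expR_ge0.
- move=> h hb; have hN : (size h < N)%N by exact: ltn_trans bN.
  under eq_bigr do rewrite mulr_sumr.
  rewrite exchange_big /=; apply: ler_sum => v _.
  have [ha|ha] := ltnP (size h) a.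
    rewrite (eq_bigr (fun x => arrival_law eps sel h x * f v h)) => [|x _].
      by rewrite -mulr_suml arrival_law_sum // mul1r.
    rewrite /f /cnt tally_rcons leqNgt ha /= addn0 size_rcons.
    by rewrite (maxn_idPl ha) (maxn_idPl (ltnW ha)).
  pose g e : R := if joins (A h) v e then expR s else 1.
  rewrite (eq_bigr (fun x => arrival_law eps sel h x * g x.1 *
      expR (s * (cnt v h)%:R - s * k + z * (b - (size h).+1)%:R))) => [|x _]; last first.
    rewrite /f /cnt tally_rcons ha /= size_rcons (maxn_idPr _) 1?leqW //.
    rewrite -mulrA /g; congr (_ * _); case: joins; rewrite -?expRD ?mul1r ?addn0 //.
    by rewrite addn1 -natr1; congr expR; ring.
  rewrite -mulr_suml sum_arrival_law_edge // sum_fresh_if //.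
  rewrite /f (maxn_idPr ha).
  have -> : (b - size h = (b - (size h).+1).+1)%N by rewrite subnSK.
  rewrite -natr1 mulrDr mulr1 addrA [X in _ <= X]expRD [leLHS]mulrC ler_wpM2l ?expR_ge0 //.
  apply: le_trans (expR_ge1Dx z); rewrite lerD2l /z -mulrA ler_wpM2l //.
  apply: ler_pM; rewrite ?invr_ge0 ?ler0n //.
    apply: le_trans (AB h); rewrite ler_nat; apply: leq_trans (card_joins _ v).
    apply: subset_leq_card; apply/fintype.subsetP => e; rewrite 4!inE.
    by case/andP=> /andP[_ ->] ->.
  rewrite lef_pV2 ?posrE ?ltr0n ?subn_gt0 ?fresh_gt0 // ler_nat.
  by apply: leq_trans (card_fresh_ge h); rewrite leq_sub2l // ltnW.
- move=> w _ /existsP[v kv].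
  rewrite (bigD1 v) //= -[leLHS]addr0; apply: lerD; last first.
    by apply: sumr_ge0 => u _; exact: expR_ge0.
  rewrite -expR0 ler_expR addr_ge0 ?mulr_ge0 //.
  by rewrite subr_ge0 ler_wpM2l.
Qed.

End Windows.

(** * Isolated vertices and the time tau_q *)

Section Isolated.
Variables (R : realType) (q : nat) (eps : R) (sel : tie_rule q) (n : nat).
Hypothesis q_gt0 : (0 < q)%N.
Implicit Types (h : history n q) (v u : 'I_n) (c : 'I_q) (e : {set 'I_n}).

Local Notation N := 'C(n, 2).

Definition isolated h : {set 'I_n} := [set v | deg h v == 0%N].

Lemma isolated_rcons h x : isolated (rcons h x) = isolated h :\: x.1.
Proof. by apply/setP => v; rewrite !inE deg_rcons addn_eq0 eqb0 andbC. Qed.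

(** By convexity the exponential lies below its chord over [0, 2]; [k] will be the number of
    isolated vertices hit by one edge. *)
Lemma expR_secant (s : R) (k : nat) : (k <= 2)%N ->
  expR (s * k%:R) <= 1 + k%:R * ((expR (2 * s) - 1) / 2).
Proof.
have e2 : expR (2 * s) = expR s ^+ 2 by rewrite -expRM_natl.
case: k => [|[|[|]]] // _; first by rewrite mulr0 expR0 mul0r addr0.
  by have := sqr_ge0 (expR s - 1); rewrite mulr1 mul1r e2; nra.
by rewrite mulrC; lra.
Qed.

(** Double counting: a vertex lies in at most n - 1 fresh pairs. *)
Lemma sum_card_isolated h :
  (\sum_(e in fresh h) #|isolated h :&: e| <= #|isolated h| * n)%N.
Proof.
under eq_bigr do rewrite -sum1_card big_mkcond.
rewrite exchange_big /= -sum_nat_const [leqRHS]big_mkcond /=; apply: leq_sum => v _.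
case: ifP => vi; last by rewrite big1 // => e _; rewrite !inE; move: vi; rewrite inE => ->.
rewrite -big_mkcondr sum1_card; apply: leq_trans (leq_pred n).
rewrite -(card_star v); apply: subset_leq_card; apply/fintype.subsetP => e.
case/andP=> fe; rewrite inE => /andP[_ ve]; rewrite !inE ve andbT.
by move: fe; rewrite !inE => /andP[].
Qed.

(** The hypothesis on [s] is the supermartingale condition for one arrival. It compares the old
    exponent s exp (- y) with the new exponent [s], reduced by the mean loss of isolated
    vertices. *)
Lemma Pr_no_isolated (T : nat) (sigma y : R) : (T < N)%N -> 0 <= sigma -> 0 <= y ->
  (forall s, 0 <= s <= sigma ->
    s * expR (- y) + n%:R / (N - T)%:R * ((expR (2 * s) - 1) / 2) <= s) ->
  Pr eps sel [pred w : outcome q n | isolated (take T w) == finset.set0]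
  <= expR (- (sigma * expR (- (y * T%:R)) * n%:R)).
Proof.
move=> TN sigma0 y0 hs.
(* The exponent grows by the factor exp y per arrival and reaches [sigma] at time [T]; if no
   isolated vertex is left then, the potential equals 1. *)
pose rate (i : nat) := sigma * expR (- (y * (T - i)%:R)).
pose F h := expR (- (rate (size h) * #|isolated h|%:R)).
have -> : expR (- (sigma * expR (- (y * T%:R)) * n%:R)) = F [::].
  rewrite /F /rate subn0; congr (expR (- (_ * _%:R))).
  by rewrite -[LHS]card_ord; apply: eq_card => v; rewrite !inE.
apply: (Pr_potential (F := F) (b := T)) => //.
- exact: ltnW.
- by move=> h; exact: expR_ge0.
- move=> h hT; have hN := ltn_trans hT TN.
  set s := rate (size h).+1; set m := #|isolated h|.
  have rateE : rate (size h) = s * expR (- y).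
    rewrite /s /rate -mulrA -expRD; congr (_ * expR _).
    by rewrite -(subnSK hT) -natr1; ring.
  have s_bd : 0 <= s <= sigma.
    rewrite mulr_ge0 ?expR_ge0 //= ler_piMr // expR_le1 oppr_le0.
    by rewrite mulr_ge0.
  set D := (expR (2 * s) - 1) / 2.
  have D0 : 0 <= D.
    by rewrite divr_ge0 // subr_ge0 -expR0 ler_expR mulr_ge0 //; case/andP: s_bd.
  pose g e : R := expR (s * #|isolated h :&: e|%:R).
  rewrite (eq_bigr (fun x => arrival_law eps sel h x * g x.1 * expR (- (s * m%:R))))
    => [|x _]; last first.
    rewrite -mulrA -expRD /F size_rcons isolated_rcons; congr (_ * expR _).
    by rewrite /m -(cardsID x.1 (isolated h)) natrD -/s; ring.
  rewrite -mulr_suml sum_arrival_law_edge //.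
  have NT : 0 < (N - T)%:R :> R by rewrite ltr0n subn_gt0.
  have f0 : 0 < #|fresh h|%:R :> R by rewrite ltr0n fresh_gt0.
  have avg : (\sum_(e in fresh h) g e) / #|fresh h|%:R <=
      1 + n%:R / (N - T)%:R * D * m%:R.
    apply: (@le_trans _ _ (1 + (\sum_(e in fresh h) #|isolated h :&: e|)%:R * D / #|fresh h|%:R)).
      rewrite ler_pdivrMr // mulrDl mul1r divfK ?gt_eqF //.
      rewrite natr_sum mulr_suml -sum1_card natr_sum -big_split /=.
      apply: ler_sum => e /fresh_pair e2; apply: expR_secant.
      by have := subset_leq_card (finset.subsetIr (isolated h) e); rewrite e2.
    rewrite lerD2l.
    rewrite [leLHS](_ : _ = D * ((\sum_(e in fresh h) #|isolated h :&: e|)%:R / #|fresh h|%:R));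
      last by ring.
    rewrite [leRHS](_ : _ = D * ((m * n)%:R / (N - T)%:R)); last by rewrite natrM; ring.
    rewrite ler_wpM2l // ler_pM ?invr_ge0 // ?ler_nat ?sum_card_isolated //.
    rewrite lef_pV2 ?posrE // ler_nat.
    by apply: leq_trans (card_fresh_ge h); rewrite leq_sub2l // ltnW.
  apply: (@le_trans _ _ (expR (n%:R / (N - T)%:R * D * m%:R) * expR (- (s * m%:R)))).
    rewrite ler_wpM2r ?expR_ge0 //; apply: le_trans avg _; exact: expR_ge1Dx.
  rewrite -expRD ler_expR rateE -/m.
  have := hs s s_bd; rewrite -/D => /(ler_wpM2r (ler0n R m)); lra.
- by move=> w _ /eqP iso0; rewrite /F iso0 cards0 mulr0 oppr0 expR0.
Qed.

Definition alive h := [exists v, (deg h v < q)%N].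

Lemma deg_take b h v : (deg (take b h) v <= deg h v)%N.
Proof. by rewrite -{2}(cat_take_drop b h) /deg count_cat leq_addr. Qed.

Lemma alive_take b h : alive h -> alive (take b h).
Proof.
by case/existsP=> v hv; apply/existsP; exists v; apply: leq_ltn_trans hv; exact: deg_take.
Qed.

Lemma alive_rcons h x : alive (rcons h x) -> alive h.
Proof. by move/(alive_take (size h)); rewrite -cats1 take_size_cat. Qed.

(** Degrees only grow, so minimum degree [q] in some prefix is the same as minimum degree [q] in
    [h]. *)
Lemma tau_alive h : (tau h <= size h)%N = ~~ alive h.
Proof.
rewrite /tau -ltnS -{2}(size_iota 0 (size h).+1) -has_find.
apply/hasP/idP => [[t _ /forallP ht]|nalive].
  apply/existsP => -[v]; rewrite ltnNge => /negP; apply.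
  by apply: leq_trans (ht v) (deg_take _ _ _).
exists (size h); first by rewrite mem_iota /= add0n ltnS.
rewrite take_size; apply/forallP => v; rewrite leqNgt; apply: contra nalive => hv.
by apply/existsP; exists v.
Qed.

End Isolated.

Lemma bin2_double n : ('C(n, 2) * 2 = n * n.-1)%N.
Proof. by rewrite -[X in (_ * X)%N]/(2`!) bin_ffact ffactnS ffactn1. Qed.

(** * Colours seen before time t_eps *)

Section Fullness.
Variables (R : realType) (q : nat) (eps : R) (sel : tie_rule q) (n : nat).
Hypothesis q_gt0 : (0 < q)%N.
Implicit Types (h : history n q) (v u : 'I_n) (c : 'I_q) (e : {set 'I_n}).

Local Notation N := 'C(n, 2).

Lemma cdeg_take b h c v : (cdeg (take b h) c v <= cdeg h c v)%N.
Proof. by rewrite -{2}(cat_take_drop b h) /cdeg count_cat leq_addr. Qed.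

Lemma legal_step5 h x : alive h -> arrival_law eps sel h x != 0 ->
  missing h x.1 != finset.set0 -> exists cb, x.2 = Some cb /\ cb.1 \in missing h x.1.
Proof.
move=> ah /legal_color; rewrite /color_law tau_alive ah /= /step_of => + m0.
rewrite m0; case: x.2 => [[c b]|]; last by rewrite eqxx.
by case: b; case: (boolP (c \in _)) => cm; rewrite /= ?mul0r ?eqxx // => _; exists (c, true).
Qed.

Definition forced u h := tally (fun h (x : arrival n q) =>
  (u \in x.1) && (missing h x.1 != finset.set0) : nat) h.

Definition unseen h := [set p : 'I_n * 'I_q | cdeg h p.2 p.1 == 0%N].

(* A Step 5 edge gives one of its endpoints a colour that the endpoint had not
   seen, so [unseen] shrinks. *)
Lemma sum_forced h : legal eps sel h -> alive h ->
  (\sum_u forced u h + 2 * #|unseen h| <= 2 * (n * q))%N.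
Proof.
elim/last_ind: h => [_ _|h x IHh /legal_rcons[lh lx] /alive_rcons ah].
  rewrite big1 // add0n leq_mul2l /=.
  by apply: leq_trans (max_card _) _; rewrite card_prod !card_ord.
have {IHh} := IHh lh ah; apply: leq_trans.
have sub : unseen (rcons h x) \subset unseen h.
  apply/fintype.subsetP => p; rewrite !inE cdeg_rcons.
  by rewrite addn_eq0 => /andP[].
rewrite /forced; under eq_bigr do rewrite tally_rcons.
rewrite big_split /= -addnA leq_add2l.
have [m0|m0] := eqVneq (missing h x.1) finset.set0.
  rewrite big1 ?add0n ?leq_mul2l ?subset_leq_card // => u _.
  by rewrite andbF.
have -> : (\sum_u ((u \in x.1) && true))%N = 2.
  rewrite -(fresh_pair (legal_edge lx)) -sum1_card [RHS]big_mkcond.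
  by apply: eq_bigr => u _; rewrite andbT; case: ifP.
rewrite -[X in (X + _ <= _)%N](muln1 2) -mulnDr leq_mul2l /= add1n.
apply: proper_card; rewrite properE sub /=.
have [[c b] [xc /=]] := legal_step5 ah lx m0; rewrite inE => /existsP[v /andP[vx cv]].
apply/subsetPn; exists (v, c); rewrite inE //= cdeg_rcons.
by rewrite /has_color xc vx /= eqxx addn1.
Qed.

(** Counting Step 5 edges together with edges of colour [c] makes the contraction independent of the
    past. A Step 5 edge at [u] always gains the factor 1/2; any other edge at [u] before [t_eps]
    falls under Step 4 and has colour [c] with probability 1/q. *)
Lemma sum_color_step h e u c : alive h -> (size h < t_eps eps n)%N -> #|e| = 2 ->
  \sum_l color_law eps sel h e l *
    2^-1 ^+ (((u \in e) && has_color c (e, l)) + ((u \in e) && (missing h e != finset.set0)))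
  <= if u \in e then 1 - (2 * q%:R)^-1 else 1.
Proof.
move=> ah hT e2; case: (boolP (u \in e)) => ue; last first.
  by under eq_bigr do rewrite /= expr0 mulr1; rewrite color_law_sum.
have q1 : 1 <= q%:R :> R by rewrite ler1n.
have qV : 0 < (q%:R^-1 : R) <= 1 by rewrite invr_gt0 ltr0n q_gt0 invf_le1 ?ltr0n.
have half : 0 <= (2^-1 : R) <= 1 by lra.
case: eqP => [m0|m0].
  rewrite sum_labels /color_law tau_alive ah /= mul0r add0r /step_of m0 eqxx hT /=.
  under eq_bigr => c' _ do rewrite !mul0r addr0 addn0 div1r /has_color /=.
  rewrite (bigD1 c) //= eqxx expr1 (eq_bigr (fun=> q%:R^-1)) => [|c' cc']; last first.
    by rewrite -[Some c' == _]/(c' == c) (negPf cc') expr0 mulr1.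
  rewrite sumr_const cardC1 card_ord -[_^-1 *+ _]mulr_natr -subn1 natrB // invfM.
  by rewrite mulrBr mulVf ?gt_eqF ?ltr0n // mulr1; lra.
apply: (@le_trans _ _ (\sum_l color_law eps sel h e l * 2^-1)).
  apply: ler_sum => l _; rewrite ler_wpM2l ?color_law_ge0 //= addn1 exprS.
  by rewrite ler_piMr ?exprn_ile1 //; lra.
by rewrite -mulr_suml color_law_sum // invfM; lra.
Qed.

Definition low A h : {set 'I_n} := [set u | [exists c, (cdeg h c u <= A)%N]].

(** While degrees are at most [d], the next edge meets [u] with probability at least (n - 1 - d) /
    N. By [sum_color_step] the mean weight of each pair (u, c) then shrinks by the factor 1 - (n - 1
    - d) / (2 q N). *)
Lemma Pr_low (T d A K : nat) (M : R) : (T <= t_eps eps n)%N -> (T <= N)%N ->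
  (0 < K)%N -> 0 < M -> (d < n)%N -> (0 < N)%N ->
  Pr eps sel [pred w : outcome q n | [&& alive (take T w),
      [forall u, (deg (take T w) u <= d)%N] &
      M + (2 * (n * q))%:R / K%:R <= #|low A (take T w)|%:R]]
  <= 2 ^+ (A + K) / M * (n * q)%:R *
     (1 - (n.-1 - d)%:R / (2 * q%:R * N%:R)) ^+ T.
Proof.
move=> Tt TN K0 M0 dn N0.
set r := 1 - _; set W := 2 ^+ (A + K) / M.
have W0 : 0 < W by rewrite divr_gt0 ?exprn_gt0.
have NR : 0 < N%:R :> R by rewrite ltr0n.
have qR : 1 <= q%:R :> R by rewrite ler1n.
have r0 : 0 <= r.
  rewrite subr_ge0 ler_pdivrMr ?mul1r ?mulr_gt0 ?ltr0n //.
  have le2 : (n.-1 - d)%:R <= 2 * N%:R :> R.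
    rewrite -natrM ler_nat mulnC bin2_double; apply: leq_trans (leq_subr _ _) _.
    by rewrite leq_pmull //; apply: leq_ltn_trans dn.
  by apply: le_trans le2 _; rewrite ler_pM2r // ler_peMr.
(* Both conditions in the indicator pass to prefixes, so once it vanishes it stays zero and the
   potential cannot grow there. *)
pose w h u c : R := (alive h && (deg h u <= d)%N)%:R *
  2^-1 ^+ (cdeg h c u + forced u h) * r ^+ (T - size h).
have w0 h u c : 0 <= w h u c.
  by rewrite !mulr_ge0 ?exprn_ge0 ?ler0n // invr_ge0.
have -> : W * (n * q)%:R * r ^+ T = W * \sum_(u : 'I_n) \sum_(c : 'I_q) r ^+ T.
  by rewrite -mulrA !sumr_const !card_ord -mulrnA mulnC mulr_natl.
pose F h := W * \sum_u \sum_c w h u c.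
apply: (@le_trans _ _ (F [::])); last first.
  rewrite ler_wpM2l ?(ltW W0) //; apply: ler_sum => u _; apply: ler_sum => c _.
  rewrite /w /cdeg /forced /tally /= subn0 expr0 mulr1 ler_piMl ?exprn_ge0 //.
  by case: (_ && _).
apply: (Pr_potential (F := F) (b := T)) => //.
- by move=> h; rewrite mulr_ge0 ?(ltW W0) // !sumr_ge0 // => u _; rewrite sumr_ge0.
- move=> h hT; have hN := leq_trans hT TN.
  under eq_bigr do rewrite /F mulrCA.
  rewrite -mulr_sumr ler_wpM2l ?(ltW W0) //.
  under eq_bigr do rewrite mulr_sumr.
  rewrite exchange_big /=; apply: ler_sum => u _.
  under eq_bigr do rewrite mulr_sumr.
  rewrite exchange_big /=; apply: ler_sum => c _.
  have [/andP[ah hd]|nah] := boolP (alive h && (deg h u <= d)%N); last first.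
    rewrite big1 ?w0 // => x _; rewrite /w; case: andP => [[ax dx]|_]; last first.
      by rewrite !mul0r mulr0.
    case/negP: nah; rewrite (alive_rcons ax) /=; apply: leq_trans dx.
    by rewrite deg_rcons leq_addr.
  pose x2 e l := (((u \in e) && @has_color n q c (e, l)) + ((u \in e) && (missing h e != finset.set0)))%N.
  set C := 2^-1 ^+ (cdeg h c u + forced u h) * r ^+ (T - (size h).+1).
  have C0 : 0 <= C by rewrite mulr_ge0 ?exprn_ge0 // invr_ge0.
  apply: (@le_trans _ _ (\sum_x arrival_law eps sel h x * (2^-1 ^+ x2 x.1 x.2) * C)).
    apply: ler_sum => -[e l] _; rewrite -mulrA ler_wpM2l ?arrival_law_ge0 //=.
    rewrite /w /forced tally_rcons cdeg_rcons size_rcons /= /x2 /C -/(forced u h).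
    rewrite addnACA [X in 2^-1 ^+ X]addnC exprD -!mulrA.
    rewrite ler_piMl ?mulr_ge0 ?exprn_ge0 ?invr_ge0 //.
    by case: (_ && _).
  rewrite -mulr_suml sum_arrival_law.
  have wE : w h u c = r * C.
    rewrite /w ah hd mul1r /C mulrCA -exprS subnSK //.
  rewrite wE ler_wpM2r //.
  apply: (@le_trans _ _ ((\sum_(e in fresh h) (if u \in e then 1 - (2 * q%:R)^-1 else 1)) / #|fresh h|%:R)).
    rewrite ler_wpM2r ?invr_ge0 //; apply: ler_sum => e /fresh_pair e2.
    apply: sum_color_step => //; exact: leq_trans Tt.
  rewrite sum_fresh_if // /r lerD2l.
  have f0 : 0 < #|fresh h|%:R :> R by rewrite ltr0n fresh_gt0.
  rewrite (_ : 1 - (2 * q%:R)^-1 - 1 = - (2 * q%:R)^-1 :> R); last by ring.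
  rewrite mulNr mulNr lerN2 invfM mulrCA -mulrA ler_wpM2l ?invr_ge0 ?mulr_ge0 //.
  rewrite ler_pM ?invr_ge0 //.
    rewrite ler_nat; apply: leq_trans (card_fresh_star h u).
    by rewrite leq_sub2l.
  by rewrite lef_pV2 ?posrE // ler_nat card_fresh_le.
- move=> x lx /and3P[ax /forallP dx Mx]; set h := take T x.
  have lh : legal eps sel h by exact: legal_take.
  (* By [sum_forced] all but 2 n q / K vertices are lazy, so at least [M] lazy vertices are low.
     Each of them contributes at least 2^-(A + K), which [W] normalizes. *)
  pose lazy := [set u | (forced u h < K)%N].
  have few : #|~: lazy|%:R <= (2 * (n * q))%:R / K%:R :> R.
    rewrite ler_pdivlMr ?ltr0n // -natrM ler_nat.
    apply: leq_trans (leq_trans (leq_addr _ _) (sum_forced lh ax)).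
    rewrite -sum_nat_const [leqLHS]big_mkcond /=; apply: leq_sum => u _.
    by rewrite !inE -leqNgt; case: ifP.
  have many : M <= #|low A h :&: lazy|%:R.
    rewrite -(lerD2r ((2 * (n * q))%:R / K%:R)); apply: le_trans Mx _.
    rewrite -/h -(cardsID lazy (low A h)) natrD lerD2l; apply: le_trans few.
    by rewrite ler_nat subset_leq_card // finset.setDE finset.subsetIr.
  rewrite /F /W -[leLHS](mulfV (lt0r_neq0 M0)) -mulrA.
  rewrite mulrCA.
  rewrite [leLHS](_ : _ = 2 ^+ (A + K) * (M^-1 * (M * 2^-1 ^+ (A + K)))); last first.
    by rewrite exprVn; field; rewrite expf_neq0 //= gt_eqF.
  rewrite mulrCA ler_pM2l ?exprn_gt0 // ler_pM2l ?invr_gt0 //.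
  apply: (@le_trans _ _ (\sum_(u in low A h :&: lazy) 2^-1 ^+ (A + K))).
    by rewrite sumr_const -[_ ^+ _ *+ _]mulr_natl ler_wpM2r // exprn_ge0 ?invr_ge0.
  rewrite big_mkcond; apply: ler_sum => u _ /=.
  case: ifP => [|_]; last by rewrite sumr_ge0.
  rewrite !inE => /andP[/existsP[c cA] uK].
  rewrite (bigD1 c) //= -[leLHS]addr0; apply: lerD; last by rewrite sumr_ge0.
  rewrite /w ax dx mul1r.
  have -> : (T - size h = 0)%N by rewrite /h size_take size_tuple; case: ltnP; lia.
  rewrite mulr1 ler_wiXn2l ?invr_ge0 ?invf_le1 ?ler1n //.
  by rewrite leq_add // ltnW.
Qed.

End Fullness.

(** * Deterministic consequences of the colouring rule *)

Section Coloring.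
Variables (R : realType) (q : nat) (eps : R) (sel : tie_rule q) (n : nat).
Hypothesis q_gt0 : (0 < q)%N.
Hypothesis sel_min : valid_ties sel.
Hypothesis thr_gt0 : 0 < threshold q eps n.
Implicit Types (h : history n q) (v u : 'I_n) (c : 'I_q) (e : {set 'I_n}).

Local Notation N := 'C(n, 2).
Local Notation T1 := (t_eps eps n).

Lemma Full_catl h s : Full eps h \subset Full eps (h ++ s).
Proof.
apply/fintype.subsetP => v; rewrite !inE => /forallP hv; apply/forallP => c.
apply: le_trans (hv c) _; rewrite ler_nat take_cat.
case: ltnP => // hT; apply: leq_trans (cdeg_take _ _ _ _) _.
by rewrite /cdeg count_cat leq_addr.
Qed.

Lemma Full_cat h s : (T1 <= size h)%N -> Full eps (h ++ s) = Full eps h.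
Proof. by move=> hT; rewrite /Full takel_cat. Qed.

Lemma Full_seen h u c : u \in Full eps h -> (0 < cdeg h c u)%N.
Proof.
rewrite inE => /forallP /(_ c) hc; apply: leq_trans (cdeg_take T1 h c u).
by rewrite -(ltr_nat R) (lt_le_trans thr_gt0).
Qed.

(** The other end [u] is [Full] and has seen every colour. In Step 5 the new colour is therefore
    missing at [v], where its degree 0 is minimal; otherwise Step 2 applies and [sel] minimizes. *)
Lemma color_min h x v : alive h -> arrival_law eps sel h x != 0 ->
  v \notin Full eps h -> (T1 <= size h)%N -> joins (Full eps h) v x.1 ->
  exists cb, x.2 = Some cb /\ forall c, (cdeg h cb.1 v <= cdeg h c v)%N.
Proof.
move=> ah lx vF hT /andP[vx /existsP[u /and3P[uF uv ux]]].
have xE := pairE (fresh_pair (legal_edge lx)) vx ux uv.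
have [m0|m0] := eqVneq (missing h x.1) finset.set0; last first.
  have [cb [xcb cm]] := legal_step5 ah lx m0; exists cb; split=> // c.
  move: cm; rewrite inE => /existsP[v' /andP[]]; rewrite xE !inE.
  case/orP=> /eqP -> /eqP c0; first by rewrite c0.
  by have := Full_seen cb.1 uF; rewrite c0.
have F1 : x.1 :&: Full eps h = [set u].
  apply/setP => z; rewrite xE !inE -[[forall c, _]](_ : z \in Full eps h = _); last by rewrite inE.
  have [->|zu] := eqVneq z u; first by rewrite orbT uF.
  by rewrite orbF; have [->|] := eqVneq z v; rewrite ?(negPf vF).
move/legal_color: lx; rewrite /color_law tau_alive ah /= /step_of m0 eqxx /= ltnNge hT /=.
rewrite F1 cards1 /=; case: x.2 => [[c [|]]|]; rewrite ?eqxx //=.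
case: existsP => [[z /andP[zx /eqP cE]] _|]; last by rewrite eqxx.
exists (c, true); split=> //= c'; suff -> : v = z by rewrite cE sel_min.
move: zx; rewrite inE xE !inE -[[forall c, _]](_ : z \in Full eps h = _); last by rewrite inE.
by case/andP=> zF /orP[] /eqP // zu; rewrite zu uF in zF.
Qed.

Lemma greedy h v k : legal eps sel h -> alive h -> v \notin Full eps h ->
  (minn (q * k) (tally (fun h x => (T1 <= size h)%N && joins (Full eps h) v x.1 : nat) h)
   <= \sum_c minn (cdeg h c v) k)%N.
Proof.
elim/last_ind: h => [|h x IHh]; first by rewrite minn0.
case/legal_rcons=> lh lx /alive_rcons ah vF'.
have vF : v \notin Full eps h.
  by apply: contra vF'; rewrite -cats1; apply/fintype.subsetP; exact: Full_catl.
have {IHh} IHh := IHh lh ah vF; rewrite tally_rcons.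
have mono : (\sum_c minn (cdeg h c v) k <= \sum_c minn (cdeg (rcons h x) c v) k)%N.
  by apply: leq_sum => c _; rewrite cdeg_rcons; lia.
case: (boolP (_ && _)) => [/andP[hT jx]|_]; last by rewrite addn0 (leq_trans IHh).
have [[c b] [/= xc cmin]] := color_min ah lx vF hT jx.
(* If the minimal degree is at least [k], every term is capped and the sum is q k; otherwise the
   term of [c] rises by one. *)
have [ck|ck] := ltnP (cdeg h c v) k; last first.
  have -> : (\sum_c minn (cdeg (rcons h x) c v) k = q * k)%N.
    rewrite -[q in RHS]card_ord -sum_nat_const; apply: eq_bigr => c' _.
    by apply/minn_idPr; rewrite cdeg_rcons; have := cmin c'; lia.
  exact: geq_minl.
suff : (\sum_c minn (cdeg h c v) k < \sum_c minn (cdeg (rcons h x) c v) k)%N.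
  rewrite addn1; move: IHh; move: (\sum_c _)%N (\sum_c _)%N (tally _ _) (q * k)%N.
  by move=> *; lia.
rewrite (bigD1 c) //= [ltnRHS](bigD1 c) //= -addSn leq_add //.
  rewrite cdeg_rcons /has_color xc /= eqxx andbT.
  by case/andP: jx => -> _ /=; lia.
by apply: leq_sum => c' _; rewrite cdeg_rcons; lia.
Qed.

Lemma dstar_tally (w : outcome q n) c v :
  dstar eps w c v = tally (fun h x =>
    [&& v \in x.1, has_color c x & ~~ is_step3 (step_of eps h x.1)] : nat) w.
Proof.
rewrite -tally_tuple /dstar -sum1_card big_mkcond; apply: eq_bigr => i _.
by rewrite inE; case: ifP.
Qed.

(** Membership in [Full] is decided by the first [t_eps] edges, and none of these falls under Step
    3. *)
Lemma dstar_Full (w : outcome q n) c v :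
  v \in Full eps w -> threshold q eps n <= (dstar eps w c v)%:R.
Proof.
rewrite inE => /forallP /(_ c) /le_trans; apply; rewrite ler_nat.
rewrite dstar_tally /cdeg count_tally tally_take; apply: leq_tally => p x s _.
case: ltnP => // pT; case: (_ \in _) => //=; case: has_color => //=.
by rewrite /step_of pT; case: ifP.
Qed.

(** A Step 3 edge at [v] would put [v] in [Full] at that time, and [Full] never loses vertices. *)
Lemma dstar_not_Full (w : outcome q n) c v : legal eps sel w ->
  v \notin Full eps w -> (cdeg w c v <= dstar eps w c v)%N.
Proof.
move=> lw vF; rewrite dstar_tally /cdeg count_tally; apply: leq_tally => p x s wE.
case: (boolP (v \in x.1)) => //= vx; case: has_color => //=.
have x2 := fresh_pair (legal_edge (lw _ _ _ wE)).
rewrite /step_of; case: ifP => // _; case: ifP => // _; case: ifP => // _.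
case: ifP => // /eqP xF.
case/negP: vF; rewrite wE; apply: (fintype.subsetP (Full_catl _ _)).
have /eqP xE : x.1 :&: Full eps p == x.1 by rewrite eqEcard finset.subsetIl xF x2.
rewrite -xE in vx.
by move: vx; rewrite finset.in_setI => /andP[].
Qed.

(** Replacing the complement of [Full] by the empty set when it is too large makes [A] bounded by
    [B] on every history, as [Pr_window] requires; along the present [w] the two agree from time
    [T1] on. *)
Lemma large_ok_of_counts (om : R) (w : outcome q n) (T2 k : nat) (B k1 : R) :
  let m := m_edges q n om in
  let A h := if #|~: Full eps h|%:R <= B then ~: Full eps h else finset.set0 in
  legal eps sel w -> (T1 <= T2)%N ->
  ~~ crowded (fun=> [set: 'I_n]) 0 T1 k1 w -> ~~ crowded (fun=> [set: 'I_n]) T2 m k1 w ->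
  ~~ crowded A T1 m k1 w ->
  isolated (take T2 w) != finset.set0 -> #|~: Full eps w|%:R <= B ->
  4 * k1 <= ln n%:R / (100 * q%:R) -> (q * k)%:R <= k1 -> threshold q eps n <= k%:R ->
  large_ok eps om w.
Proof.
move=> m A lw T12 /existsPn few1 /existsPn few2 /existsPn few3 /set0Pn[z]; rewrite inE => /eqP z0 FB k14 qk1 thrk.
apply/forallP => v; apply/implyP; rewrite inE => vL; apply/forallP => c.
case: (boolP (v \in Full eps w)) => vF; first exact: dstar_Full.
apply: le_trans thrk _; rewrite ler_nat; apply: leq_trans (dstar_not_Full c lw vF).
apply: leq_trans (cdeg_take T2 w c v).
have az : alive (take T2 w) by apply/existsP; exists z; rewrite z0.
have vF2 : v \notin Full eps (take T2 w).
  apply: contra vF => vF2; rewrite -(cat_take_drop T2 w).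
  exact: (fintype.subsetP (Full_catl _ _)).
have := greedy k (legal_take (b := T2) lw) az vF2.
set G := tally _ _ => Gk.
have {}Gk : (q * k <= \sum_c minn (cdeg (take T2 w) c v) k)%N.
  apply: leq_trans Gk; rewrite leq_min leqnn /=.
  have := few1 v; have := few2 v; have := few3 v; rewrite -!ltNge.
  rewrite -(ler_nat R); move: qk1 k14 vL; rewrite -/m.
  set t1 := tally _ _; set t2 := tally _ _; set t3 := tally _ _.
  (* Each edge at [v] before [m] comes before [T1], after [T2], or in between with its other end
     outside or inside [Full]. The first three tallies stay below [k1] and the degree is at least 4
     k1, so [G] exceeds [k1]. *)
  have : (deg (take m w) v <= t1 + t2 + t3 + G)%N.
    rewrite /deg count_tally /t1 /t2 /t3 /G !tally_take -!tallyD; apply: leq_tally => p x s wE.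
    case: ltnP => // pm; case: (boolP (v \in x.1)) => // vx.
    have x2 := fresh_pair (legal_edge (lw _ _ _ wE)).
    rewrite !joinsT // vx /=; case: (ltnP (size p) T1) => pT1; first by rewrite addn1 addSn.
    case: (ltnP (size p) T2) => pT2; last by lia.
    have Fp : Full eps p = Full eps w by rewrite wE Full_cat.
    have : joins [set: 'I_n] v x.1 by rewrite joinsT.
    case/andP=> _ /existsP[u /and3P[_ uv ux]].
    have [uF|uF] := boolP (u \in Full eps p).
      have -> : joins (Full eps p) v x.1.
        by rewrite /joins vx; apply/existsP; exists u; rewrite uF uv.
      by lia.
    have -> : joins (A p) v x.1.
      rewrite /joins vx; apply/existsP; exists u; rewrite /A Fp FB.
      by rewrite finset.in_setC -Fp uF uv.
    by lia.
  rewrite -(ler_nat R) !natrD; lra.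
(* One colour below [k] would keep the capped sum below q k. *)
rewrite leqNgt; apply/negP => ck; move: Gk; rewrite leqNgt => /negP; apply.
rewrite (bigD1 c) //= (minn_idPl (ltnW ck)).
apply: (@leq_trans (k + \sum_(i < q | i != c) k)%N).
  by rewrite -addSn leq_add // leq_sum // => i _; rewrite geq_minr.
by rewrite sum_nat_const cardC1 card_ord -mulSn prednK.
Qed.

End Coloring.

(** * The union bound *)

Section Bounds.
Variables (R : realType) (q : nat) (eps : R) (sel : tie_rule q) (n : nat).
Hypothesis q_gt0 : (0 < q)%N.
Hypothesis sel_min : valid_ties sel.
Hypothesis thr_gt0 : 0 < threshold q eps n.

Implicit Types h : history n q.

Local Notation N := 'C(n, 2).
Local Notation T1 := (t_eps eps n).

(** The fifth event carries side conditions supplied by the failure of earlier ones: the first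
    window bounds the degrees by [d], and a vertex isolated at [T2] keeps [T1] before tau_q. As [k]
    is the integer part of the threshold, a vertex outside [Full] is [low k]. *)
Lemma Pr_not_large_ok (om : R) (T2 k K d : nat) (B k1 M : R) :
  let m := m_edges q n om in
  let A h := if #|~: Full eps h|%:R <= B then ~: Full eps h else finset.set0 in
  (T1 <= T2)%N -> 4 * k1 <= ln n%:R / (100 * q%:R) -> (q * k.+1)%:R <= k1 ->
  k%:R <= threshold q eps n < k.+1%:R -> M + (2 * (n * q))%:R / K%:R <= B ->
  k1 <= d%:R ->
  Pr eps sel (predC (large_ok (n := n) eps om)) <=
    Pr eps sel (crowded (n := n) (fun=> [set: 'I_n]) 0 T1 k1) +
    (Pr eps sel (crowded (n := n) (fun=> [set: 'I_n]) T2 m k1) +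
    (Pr eps sel (crowded A T1 m k1) +
    (Pr eps sel [pred w : outcome q n | isolated (take T2 w) == finset.set0] +
     Pr eps sel [pred w : outcome q n | [&& alive (take T1 w),
      [forall u, (deg (take T1 w) u <= d)%N] &
      M + (2 * (n * q))%:R / K%:R <= #|low k (take T1 w)|%:R]]))).
Proof.
move=> m A T12 k14 qk /andP[kt tk] MB kd.
set E1 := crowded _ 0 T1 k1; set E2 := crowded _ T2 m k1; set E3 := crowded A T1 m k1.
set E4 := [pred w : outcome q n | isolated (take T2 w) == _].
set E5 := [pred w : outcome q n | [&& _, _ & _]].
apply: (@le_trans _ _ (Pr eps sel (predU E1 (predU E2 (predU E3 (predU E4 E5)))))); last first.
  do 3![apply: le_trans (Pr_union _ _ _ _) _; rewrite lerD2l].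
  exact: Pr_union.
apply: Pr_le => w lw; apply: contraR.
rewrite !negb_or => /and5P[n1 n2 n3 n4 n5].
have [z z0] : exists z, z \in isolated (take T2 w) by apply/set0Pn.
have few1 v : (deg (take T1 w) v)%:R < k1.
  have := existsPn n1 v; rewrite -ltNge; apply: le_lt_trans.
  rewrite ler_nat /deg count_tally; apply: leq_tally => p x s wE.
  have lx : legal eps sel (take T1 w) by exact: legal_take lw.
  by rewrite joinsT // (fresh_pair (legal_edge (lx _ _ _ wE))).
have az : alive (take T1 w).
  have -> : take T1 w = take T1 (take T2 w) by rewrite take_takel.
  apply: alive_take; apply/existsP; exists z.
  by move: z0; rewrite inE => /eqP->.
have few_not_full : #|~: Full eps w|%:R <= B.
  rewrite leNgt; apply: contra n5 => BF; rewrite /E5 /= az /=.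
  apply/andP; split.
    apply/forallP => u; rewrite -(ler_nat R).
    by apply: le_trans kd; exact: ltW.
  apply: le_trans MB _; apply: le_trans (ltW BF) _; rewrite ler_nat.
  apply: subset_leq_card; apply/fintype.subsetP => u; rewrite !inE.
  case/forallPn => c; rewrite -ltNge => cu; apply/existsP; exists c.
  by rewrite -ltnS -(ltr_nat R) (lt_trans cu).
apply: (@large_ok_of_counts R q eps sel n q_gt0 sel_min thr_gt0 om w T2 k.+1 B k1) => //.
exact: ltW.
Qed.

End Bounds.

(** * Explicit estimates of the five probabilities *)

Section Numerics.
Variables (R : realType) (q : nat).
Hypothesis q_gt0 : (0 < q)%N.

(* With s = rate, the factor exp (- s L / (400 q)) = n^-3 pays for the union bound over
   the vertices and for the growth exp L of the exponential moment, because
   4 eps0 = exp (- s). *)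
Definition rate : R := 1200 * q%:R.
Definition eps0 : R := expR (- rate) / 4.

Let q1 : 1 <= q%:R :> R. Proof. by rewrite ler1n. Qed.

Lemma eps0_gt0 : 0 < eps0.
Proof. by rewrite divr_gt0 ?expR_gt0. Qed.

Lemma eps0_small : eps0 * q%:R <= 1 / 4000.
Proof.
have rq : rate = 1200 * q%:R by [].
have : expR (- rate) * (1 + rate) <= 1.
  by rewrite expRN mulrC ler_pdivrMr ?expR_gt0 // mul1r expR_ge1Dx.
have := expR_gt0 (- rate); rewrite /eps0; nra.
Qed.

Lemma expRN_le_inv (x : R) : 0 < x -> expR (- x) <= x^-1.
Proof.
move=> x0; rewrite expRN lef_pV2 ?posrE ?expR_gt0 //.
by apply: le_trans (expR_ge1Dx x); rewrite lerDr.
Qed.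

(** With l = ln x, the bound exp l >= l^2 / 2 gives c x >= (c l / 2) l >= l. *)
Lemma ln_le_mul (x c : R) : 0 < x -> 0 < c -> 2 / c <= ln x -> ln x <= c * x.
Proof.
move=> x0 c0 cx; have l0 : 0 < ln x by apply: lt_le_trans cx; rewrite divr_gt0.
have := expR_ge1Dxn 1 (ltW l0); rewrite lnK ?posrE // => xl.
rewrite ler_pdivrMr // in cx.
have : x * (2 * 1) >= ln x ^+ 2.
  by move: xl; rewrite (_ : 2`!%:R = 2) //; lra.
nra.
Qed.

Lemma bin2E n : (0 < n)%N -> 'C(n, 2)%:R = n%:R * (n%:R - 1) / 2 :> R.
Proof.
move=> n0; apply: (canRL (mulfK _)) => //.
by rewrite -natrM bin2_double natrM -subn1 natrB.
Qed.

Variables (sel : tie_rule q) (n : nat).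

Local Notation N := 'C(n, 2).
Local Notation x := (n%:R : R).
Local Notation L := (ln (n%:R : R)).

Hypothesis L1 : 1 <= L.
Hypothesis Lx : L <= eps0 / 32 * x.

Let e0 := eps0_gt0.
Let e1 : eps0 <= 1 / 100.
Proof.
have : eps0 <= eps0 * q%:R by rewrite ler_peMr ?q1 // ltW.
by have := eps0_small; lra.
Qed.

Let x16 : 32 / eps0 <= x.
Proof. by rewrite ler_pdivrMr ?eps0_gt0 //; have := L1; have := Lx; have := e0; lra. Qed.

Let x100 : 100 <= x.
Proof. by apply: le_trans x16; rewrite ler_pdivlMr ?e0 //; have := e1; lra. Qed.

Let n_gt0 : (0 < n)%N. Proof. by rewrite -(ltr_nat R); have := x100; lra. Qed.

Let NE := bin2E n_gt0.

Let xE : x = expR L. Proof. by rewrite lnK // posrE (lt_le_trans _ x100). Qed.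

(** All times considered are at most n L, far below [N], which is about n^2 / 2; the 4 here is the
    one dividing [eps0]. *)
Lemma N_sub_ge (b : nat) : b%:R <= x * L -> (b < N)%N /\ x ^+ 2 / 4 <= (N - b)%:R.
Proof.
move=> bx; have x0 := x100; have l1 := L1.
have Lx' : L <= x / 32.
  have ex : eps0 * x <= 1 / 100 * x by rewrite ler_wpM2r ?e1.
  apply: le_trans Lx _; lra.
have NX : x ^+ 2 / 4 <= N%:R - b%:R by rewrite NE; nra.
have bN : (b < N)%N by rewrite -(ltr_nat R); nra.
by rewrite natrB // ltnW.
Qed.

Lemma Pr_window_exp (A : history n q -> {set 'I_n}) (a b : nat) (beta : R) :
  0 <= beta -> (forall h, #|A h|%:R <= beta) -> b%:R <= x * L ->
  beta * (b - a)%:R <= eps0 * x ^+ 2 * L ->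
  Pr eps0 sel (crowded A a b (L / (400 * q%:R))) <= expR (- L).
Proof.
move=> beta0 Ab bx bab; have [bN NX] := N_sub_ge bx; have e0' := e0; have l1 := L1.
have r0 : 0 <= rate by exact: mulr_ge0 (ler0n _ _) (ler0n _ _).
apply: le_trans (Pr_window eps0 sel q_gt0 a _ r0 beta0 bN Ab) _.
rewrite [X in X * _]xE -expRD ler_expR.
have -> : - rate * (L / (400 * q%:R)) = - 3 * L.
  by rewrite /rate; field; rewrite pnatr_eq0 -lt0n.
(* The mean number of hits is at most 4 eps0 L, so the moment costs at most exp L. In total the
   exponent is at most L - 3 L + L. *)
have Y0 : beta / (N - b)%:R * (b - a)%:R <= expR (- rate) * L.
  have NX0 : 0 < (N - b)%:R :> R by rewrite ltr0n subn_gt0.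
  rewrite mulrAC ler_pdivrMr //; apply: le_trans bab _.
  rewrite (_ : expR (- rate) = 4 * eps0); last by rewrite /eps0; field.
  have : eps0 * L * (x ^+ 2 / 4) <= eps0 * L * (N - b)%:R.
    by rewrite ler_wpM2l // mulr_ge0 //; lra.
  lra.
have Y1 : 0 <= beta / (N - b)%:R * (b - a)%:R by rewrite !mulr_ge0 ?invr_ge0.
rewrite -mulrA; have E1 : expR rate * expR (- rate) = 1 by rewrite -expRD subrr expR0.
have := expR_gt0 rate; move: Y0 Y1; set Y := _ * _; set P := expR rate.
move=> Y0 Y1 P0; have : P * Y <= L.
  by rewrite (_ : L = P * (expR (- rate) * L)) ?ler_pM2l // mulrA E1 mul1r.
lra.
Qed.

Lemma Pr_no_isolated_inv (T : nat) : T%:R <= (1 - eps0) / 2 * (x * L) ->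
  Pr eps0 sel [pred w : outcome q n | isolated (take T w) == finset.set0]
  <= 64 / (eps0 ^+ 2 * L).
Proof.
move=> Tx; have e0' := e0; have e1' := e1; have l1 := L1; have x_ge := x100.
have x0 : 0 < x by lra.
have xL0 : 0 <= x * L by rewrite mulr_ge0 //; lra.
have TxL : T%:R <= x * L by nra.
have [TN NX] := N_sub_ge TxL.
have NX0 : 0 < (N - T)%:R :> R by rewrite ltr0n subn_gt0.
(* An isolated vertex is hit at rate about 2 / x. The surplus eps0 / 2 in [y] covers the two errors
   eps0 / 8 in [z], one from the pairs used up and one from the chord, yet is below the [eps0] saved
   in [T]. *)
pose sigma := eps0 / 32; pose y := 2 / x * (1 + eps0 / 2).
have xV : 0 < x^-1 by rewrite invr_gt0.
have y0 : 0 <= y by rewrite !mulr_ge0 //; lra.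
have s0 : 0 <= sigma by rewrite divr_ge0 //; lra.
pose z := 2 / x * (1 + eps0 / 8) ^+ 2.
have NTx : n%:R / (N - T)%:R <= 2 / x * (1 + eps0 / 8).
  rewrite ler_pdivrMr // natrB 1?ltnW // NE.
  rewrite (_ : 2 / x * (1 + eps0 / 8) * (x * (x - 1) / 2 - T%:R) =
    (1 + eps0 / 8) * (x - 1 - 2 * T%:R / x)); last by field; rewrite gt_eqF.
  have : 2 * T%:R / x <= L by rewrite ler_pdivrMr //; nra.
  have := Lx; nra.
have ez : expR (- y) + z <= 1.
  have zx : z * x = 2 * (1 + eps0 / 8) ^+ 2 by rewrite /z; field; rewrite gt_eqF.
  have yx : y * x = 2 * (1 + eps0 / 2) by rewrite /y; field; rewrite gt_eqF.
  (* This is 1 / (1 + y) + z <= 1, and exp (- y) <= 1 / (1 + y). *)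
  have yz : y - z - y * z >= 0.
    rewrite -(pmulr_lge0 _ x0) -(pmulr_lge0 _ x0).
    rewrite (_ : _ * x * x = (y * x) * x - (z * x) * x - (y * x) * (z * x)); last by ring.
    rewrite yx zx; have ex : 32 <= eps0 * x by rewrite mulrC -ler_pdivrMr.
    have : (1 + eps0 / 8) ^+ 2 <= 1 + eps0 * (3 / 8) by nra.
    set g := (1 + eps0 / 8) ^+ 2 => g1; have g0 : 0 <= g by rewrite sqr_ge0.
    nra.
  have : expR (- y) * (1 + y) <= 1.
    by rewrite expRN mulrC ler_pdivrMr ?expR_gt0 // mul1r expR_ge1Dx.
  nra.
apply: le_trans (Pr_no_isolated eps0 sel q_gt0 (T := T) (sigma := sigma) (y := y) TN s0 y0 _) _.
  move=> s /andP[s_ge0 s_le].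
  have es : (expR (2 * s) - 1) / 2 <= s * (1 + eps0 / 8).
    have : expR (2 * s) * (1 - 2 * s) <= 1.
      have := expR_ge1Dx (- (2 * s)); rewrite expRN => h1.
      have := expR_gt0 (2 * s) => p0.
      have : expR (2 * s) * (1 + - (2 * s)) <= expR (2 * s) * (expR (2 * s))^-1.
        by rewrite ler_pM2l.
      by rewrite divff ?gt_eqF.
    rewrite /sigma in s_le; have := expR_gt0 (2 * s); set E := expR _ => E0 E1; nra.
  have E0 : 0 <= (expR (2 * s) - 1) / 2.
    by rewrite divr_ge0 // subr_ge0 -expR0 ler_expR mulr_ge0.
  have : n%:R / (N - T)%:R * ((expR (2 * s) - 1) / 2) <= z * s.
    rewrite (_ : z * s = 2 / x * (1 + eps0 / 8) * (s * (1 + eps0 / 8))); last first.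
      by rewrite /z; ring.
    by rewrite ler_pM // divr_ge0.
  nra.
have yT : y * T%:R <= (1 - eps0 / 2) * L.
  apply: (@le_trans _ _ (y * ((1 - eps0) / 2 * (x * L)))); first by rewrite ler_wpM2l.
  rewrite (_ : y * _ = (1 + eps0 / 2) * (1 - eps0) * L); last by rewrite /y; field; rewrite gt_eqF.
  by rewrite ler_wpM2r //; [lra | nra].
(* The right side is at least n^(eps0 / 2); a linear bound in [L] suffices for a failure probability
   of order 1 / L. *)
have grow : eps0 * L / 2 <= expR (- (y * T%:R)) * n%:R.
  rewrite [X in _ <= _ * X]xE -expRD; apply: (@le_trans _ _ (expR (eps0 * L / 2))).
    by apply: le_trans (expR_ge1Dx _); lra.
  by rewrite ler_expR; move: yT; set t := y * _; lra.
apply: (@le_trans _ _ (expR (- (eps0 ^+ 2 * L / 64)))).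
  rewrite ler_expR lerN2 (_ : eps0 ^+ 2 * L / 64 = sigma * (eps0 * L / 2)).
    by rewrite -[leRHS]mulrA ler_wpM2l.
  by rewrite /sigma; field.
apply: le_trans (expRN_le_inv _) _.
  by rewrite divr_gt0 // mulr_gt0 ?exprn_gt0 //; lra.
by rewrite invf_div.
Qed.

Lemma Pr_low_inv (d k K : nat) : (0 < K)%N -> d%:R <= 2 * L ->
  k%:R <= threshold q eps0 n ->
  Pr eps0 sel [pred w : outcome q n | [&& alive (take (t_eps eps0 n) w),
      [forall u, (deg (take (t_eps eps0 n) w) u <= d)%N] &
      eps0 * x / 2 + (2 * (n * q))%:R / K%:R <= #|low k (take (t_eps eps0 n) w)|%:R]]
  <= 8 * (q%:R / eps0) ^+ 2 * expR (K%:R + 1) / L.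
Proof.
set T := t_eps eps0 n; set M := eps0 * x / 2.
move=> K0 dL kt; have e0' := e0; have e1' := e1; have l1 := L1; have x_ge := x100.
have x0 : 0 < x by lra.
have qp : 0 < q%:R :> R by rewrite ltr0n.
have xL0 : 0 <= eps0 * x * L by rewrite !mulr_ge0 //; lra.
have /andP[T_le /ltW T_ge] : T%:R <= eps0 * x * L < T.+1%:R by exact: truncn_itv.
rewrite -natr1 in T_ge.
have TxL : T%:R <= x * L.
  have : eps0 * (x * L) <= 1 * (x * L) by rewrite ler_wpM2r ?mulr_ge0 //; lra.
  lra.
have [TN _] := N_sub_ge TxL.
have N0 : (0 < N)%N by apply: leq_ltn_trans TN.
have Lx' : L <= x / 32.
  have ex : eps0 * x <= 1 / 100 * x by rewrite ler_wpM2r.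
  by apply: le_trans Lx _; lra.
have dn : (d < n)%N by rewrite -(ltr_nat R); lra.
have M0 : 0 < M by rewrite /M divr_gt0 // mulr_gt0.
apply: le_trans (Pr_low sel q_gt0 k (leqnn _) (ltnW TN) K0 M0 dn N0) _.
rewrite -/T; set t := _ / (2 * _ * _).
have DE : (n.-1 - d)%:R = x - 1 - d%:R :> R.
  have dn1 : (d <= n.-1)%N by rewrite -ltnS prednK.
  by rewrite natrB // -subn1 natrB.
have tE : t = (x - 1 - d%:R) / (q%:R * (x * (x - 1))).
  by rewrite /t DE NE; field; rewrite !gt_eqF //; lra.
have den : 0 < q%:R * (x * (x - 1)) by rewrite !mulr_gt0 //; lra.
have t_le : t <= 1.
  rewrite tE ler_pdivrMr // mul1r; have := q1 => q1'.
  have : 1 * (x * (x - 1)) <= q%:R * (x * (x - 1)) by rewrite ler_wpM2r // mulr_ge0 //; lra.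
  have : 1 * (x - 1) <= x * (x - 1) by rewrite ler_wpM2r //; lra.
  have : 0 <= d%:R :> R by [].
  lra.
(* Since d <= 2 L, at least half of the pairs at a vertex are still fresh. *)
have t_ge : (2 * q%:R * x)^-1 <= t.
  rewrite tE ler_pdivlMr //.
  rewrite [leLHS](_ : _ = (x - 1) / 2); last by field; rewrite !gt_eqF.
  lra.
(* The contraction over [T] arrivals gives exp (- u / 2) up to rounding, while [k] is at most the
   threshold u / 1000, so the factor 2^k is harmless. *)
pose u := eps0 * L / q%:R.
have u0 : 0 < u by rewrite divr_gt0 // mulr_gt0 //; lra.
have exponent : u / 1000 + K%:R + (1 - u / 2) <= K%:R + 1 + - (u / 4) by lra.
have tT : u / 2 - 1 <= t * T%:R.
  apply: (@le_trans _ _ ((2 * q%:R * x)^-1 * T%:R)); last by rewrite ler_wpM2r.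
  apply: (@le_trans _ _ ((2 * q%:R * x)^-1 * (eps0 * x * L - 1))); last first.
    by rewrite ler_wpM2l ?invr_ge0 ?mulr_ge0 //; lra.
  rewrite [leRHS](_ : _ = u / 2 - (2 * q%:R * x)^-1); last first.
    by rewrite /u; field; rewrite !gt_eqF.
  rewrite lerD2l lerN2 invf_le1 ?mulr_gt0 //.
  have : 1 * x <= q%:R * x by rewrite ler_wpM2r ?q1 // ltW.
  by rewrite -mulrA; lra.
have rT : (1 - t) ^+ T <= expR (1 - u / 2).
  apply: (@le_trans _ _ (expR (- t) ^+ T)).
    by apply: lerXn2r; rewrite ?nnegrE ?expR_ge0 ?subr_ge0 //; exact: expR_ge1Dx.
  by rewrite -expRM_natl ler_expR; lra.
have two : 2 ^+ (k + K) <= expR (u / 1000 + K%:R).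
  apply: (@le_trans _ _ (expR 1 ^+ (k + K))).
    have e2 : 2 <= expR 1 :> R by exact: (expR_ge1Dx (1 : R)).
    by apply: lerXn2r e2; rewrite nnegrE ?expR_ge0 ?ler0n.
  rewrite -expRM_natl mulr1 ler_expR natrD lerD2r; apply: le_trans kt _.
  by rewrite /threshold /u le_eqVlt; apply/orP; left; apply/eqP; field; rewrite gt_eqF.
have r0 : 0 <= (1 - t) ^+ T by rewrite exprn_ge0 // subr_ge0.
have nqM : M^-1 * (n * q)%:R = 2 * (q%:R / eps0).
  by rewrite /M natrM; field; rewrite !gt_eqF.
rewrite -(mulrA _ M^-1) nqM.
have qe0 : 0 < q%:R / eps0 by rewrite divr_gt0.
have c0 : 0 <= 2 * (q%:R / eps0) by rewrite mulr_ge0 // ltW.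
apply: (@le_trans _ _ (expR (u / 1000 + K%:R) * (2 * (q%:R / eps0)) * expR (1 - u / 2))).
  apply: ler_pM => //; first by rewrite mulr_ge0 ?exprn_ge0 // mulr_ge0 // ltW.
  by rewrite ler_wpM2r // mulr_ge0 // ltW.
apply: (@le_trans _ _ (2 * (q%:R / eps0) * (expR (K%:R + 1) * expR (- (u / 4))))).
  rewrite mulrAC -expRD -expRD [leLHS]mulrC; apply: ler_wpM2l => //.
  by rewrite ler_expR.
apply: (@le_trans _ _ (2 * (q%:R / eps0) * (expR (K%:R + 1) * (u / 4)^-1))).
  apply: ler_wpM2l => //; apply: ler_wpM2l; first exact: expR_ge0.
  by apply: expRN_le_inv; rewrite divr_gt0.
rewrite le_eqVlt; apply/orP; left; apply/eqP; rewrite /u; field.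
by rewrite !gt_eqF // (lt_le_trans ltr01 l1).
Qed.

End Numerics.

(** * The total failure probability is O(1 / log n) *)

Section Failure.
Variables (R : realType) (q : nat).
Hypothesis q_gt0 : (0 < q)%N.

Local Notation eps0 := (eps0 R q).

(** At least 4 q / eps0, so that at most eps0 n / 2 vertices meet this many Step 5 edges. *)
Definition lazy_bound : nat := (Num.truncn (4 * q%:R / eps0)).+1.

Definition fail_const : R :=
  3 + 64 / eps0 ^+ 2 + 8 * (q%:R / eps0) ^+ 2 * expR (lazy_bound%:R + 1).

Variables (sel : tie_rule q) (n : nat).
Hypothesis sel_min : valid_ties sel.

Local Notation N := 'C(n, 2).
Local Notation x := (n%:R : R).
Local Notation L := (ln (n%:R : R)).

Hypothesis L1 : 1 <= L.
Hypothesis Lx : L <= eps0 / 32 * x.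
Hypothesis Lq : 800 * q%:R ^+ 2 <= L.
Hypothesis LL : (q%:R - 1) * ln L <= eps0 / 2 * L.

(** The term (q - 1) log log n is absorbed into eps0 L / 2, and omega only lowers the count. *)
Lemma m_edges_le (om : R) : 0 <= om ->
  (m_edges q n om)%:R <= x / 2 * ((1 + eps0 / 2) * L).
Proof.
move=> om0; have e0 := eps0_gt0 R q; have l1 := L1.
have n0 : (0 < n)%N.
  by rewrite lt0n; apply/eqP => n0; move: l1; rewrite n0 ln0 // ler10.
have x1 : 1 <= x by rewrite ler1n.
set Y := x / 2 * _.
have Y0 : 0 <= Y by rewrite !mulr_ge0 //; lra.
have /andP[YT _] : (Num.truncn Y)%:R <= Y < (Num.truncn Y).+1%:R by exact: truncn_itv.
apply: le_trans YT; rewrite ler_nat; apply: le_truncn.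
rewrite /edge_prob bin2E //.
set S := ln _ + _ - _.
have SL : S <= (1 + eps0 / 2) * L by rewrite /S; move: LL; lra.
rewrite [leLHS](_ : _ = (x - 1) / 2 * S); last by field; rewrite gt_eqF //; lra.
apply: (@le_trans _ _ ((x - 1) / 2 * ((1 + eps0 / 2) * L))).
  by apply: ler_wpM2l => //; lra.
apply: ler_wpM2r; last by lra.
by rewrite mulr_ge0 //; lra.
Qed.

Lemma Pr_not_large_ok_inv (om : R) : 0 <= om ->
  Pr eps0 sel (predC (large_ok (n := n) eps0 om)) <= fail_const / L.
Proof.
move=> om0; have e0 := eps0_gt0 R q; have l1 := L1; have mY := m_edges_le om0.
have L0 : 0 < L by lra.
have e1 : eps0 * q%:R <= 1 by have := eps0_small R q; lra.
have q1 : 1 <= q%:R :> R by rewrite ler1n.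
have e1' : eps0 <= 1 / 4.
  have : eps0 <= eps0 * q%:R by rewrite ler_peMr // ltW.
  by have := eps0_small R q; lra.
have x0 : 0 <= x by [].
have q0 : 0 < q%:R :> R by rewrite ltr0n.
have ex : 32 * L <= eps0 * x by move: Lx; lra.
set m := m_edges q n om in mY *.
have xL0 : 0 <= x * L by rewrite mulr_ge0 // ltW.
have exL : 32 <= eps0 * (x * L).
  apply: (@le_trans _ _ (eps0 * x * 1)); first by rewrite mulr1; lra.
  by rewrite [leRHS]mulrA; apply: ler_wpM2l => //; lra.
have exL1 : eps0 * (x * L) <= 1 / 4 * (x * L) by apply: ler_wpM2r.
have {}mY : m%:R <= x * L / 2 + eps0 * (x * L) / 4.
  by apply: le_trans mY _; rewrite le_eqVlt; apply/orP; left; apply/eqP; field.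
have mxL : m%:R <= x * L by lra.
pose T1 := t_eps eps0 n.
have T1E : eps0 * x * L = eps0 * (x * L) by rewrite mulrA.
have /andP[T1x _] : T1%:R <= eps0 * x * L < T1.+1%:R by apply: truncn_itv; rewrite T1E mulr_ge0 // ltW.
rewrite T1E in T1x.
pose Y2 := (1 - eps0) / 2 * (x * L).
have Y2E : Y2 = x * L / 2 - eps0 * (x * L) / 2 by rewrite /Y2; field.
have Y20 : 0 <= Y2 by rewrite Y2E; lra.
pose T2 := Num.truncn Y2.
have /andP[T2x T2x'] : T2%:R <= Y2 < T2.+1%:R by exact: truncn_itv.
rewrite -natr1 in T2x'.
have T12 : (T1 <= T2)%N by apply: le_truncn; rewrite -/Y2 Y2E T1E; lra.
have T1xL : T1%:R <= x * L by lra.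
(* The gap is at most 3/4 eps0 n L plus 1 for rounding [T2]. *)
have mT2 : (m - T2)%:R <= eps0 * (x * L).
  case: (leqP T2 m) => [T2m|/ltnW]; first by rewrite natrB //; lra.
  by rewrite -subn_eq0 => /eqP->; lra.
have thr0 : 0 < threshold q eps0 n.
  exact: divr_gt0 (mulr_gt0 e0 L0) (mulr_gt0 (ltr0Sn _ _) q0).
pose k := Num.truncn (threshold q eps0 n).
have kt : k%:R <= threshold q eps0 n < k.+1%:R by apply: truncn_itv; exact: ltW.
pose k1 := L / (400 * q%:R).
pose d := (Num.truncn k1).+1.
have k10 : 0 <= k1 by exact: divr_ge0 (ltW L0) (mulr_ge0 (ler0n _ _) (ler0n _ _)).
have /andP[k1T Tk1] : (Num.truncn k1)%:R <= k1 < (Num.truncn k1).+1%:R by exact: truncn_itv.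
have g0 : 0 <= L / q%:R by rewrite divr_ge0 // ltW.
have k1E : k1 = L / q%:R / 400 by rewrite /k1; field; rewrite gt_eqF.
have gL : L / q%:R <= L by rewrite ler_pdivrMr // ler_peMr // ltW.
have d2 : d%:R <= 2 * L by rewrite /d -natr1; lra.
have gq : 800 * q%:R <= L / q%:R by rewrite ler_pdivlMr // -mulrA -expr2.
have eg : eps0 * L <= L / q%:R.
  by rewrite ler_pdivlMr // mulrAC ler_piMl // ltW.
have thrE : threshold q eps0 n * q%:R = eps0 * L / 1000.
  by rewrite /threshold; field; rewrite gt_eqF.
(* Here q k <= eps0 L / 1000 <= L / (1000 q), and the extra [q] is at most L / (800 q). *)
have qk : (q * k.+1)%:R <= k1.
  have : k%:R * q%:R <= threshold q eps0 n * q%:R.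
    by apply: ler_wpM2r; [exact: ltW | case/andP: kt].
  rewrite thrE mulnC natrM -[k.+1%:R]natr1 mulrDl mul1r k1E; lra.
have Kge : 4 * q%:R / eps0 <= lazy_bound%:R.
  have /andP[_ /ltW //] : (Num.truncn (4 * q%:R / eps0))%:R <= 4 * q%:R / eps0 < lazy_bound%:R.
  by apply: truncn_itv; rewrite divr_ge0 ?mulr_ge0 // ltW.
have K0 : 0 < lazy_bound%:R :> R by rewrite ltr0n.
have few : eps0 * x / 2 + (2 * (n * q))%:R / lazy_bound%:R <= eps0 * x.
  have : (2 * (n * q))%:R / lazy_bound%:R <= eps0 * x / 2.
    rewrite ler_pdivrMr // !natrM.
    rewrite ler_pdivrMr // in Kge.
    have : x * (4 * q%:R) <= x * (lazy_bound%:R * eps0) by apply: ler_wpM2l.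
    lra.
  lra.
have k14 : 4 * k1 <= L / (100 * q%:R).
  by rewrite k1E le_eqVlt; apply/orP; left; apply/eqP; field; rewrite gt_eqF.
apply: le_trans (Pr_not_large_ok q_gt0 sel_min thr0 om T12 k14 qk kt few (ltW Tk1)) _.
have cardT (h : history n q) : #|[set: 'I_n]|%:R <= x by rewrite cardsT card_ord.
have expL : expR (- L) <= 1 / L by rewrite div1r; exact: expRN_le_inv.
(* Each window has target size times length at most eps0 n^2 L: the first two are short, the third
   has a small target. *)
have W1 : Pr eps0 sel (crowded (n := n) (fun=> [set: 'I_n]) 0 T1 k1) <= 1 / L.
  apply: le_trans (Pr_window_exp q_gt0 sel L1 Lx x0 cardT T1xL _) expL.
  rewrite subn0 (_ : eps0 * x ^+ 2 * L = x * (eps0 * (x * L))); last by ring.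
  exact: ler_wpM2l.
have W2 : Pr eps0 sel (crowded (n := n) (fun=> [set: 'I_n]) T2 m k1) <= 1 / L.
  apply: le_trans (Pr_window_exp q_gt0 sel L1 Lx x0 cardT mxL _) expL.
  rewrite (_ : eps0 * x ^+ 2 * L = x * (eps0 * (x * L))); last by ring.
  exact: ler_wpM2l.
have B0 : 0 <= eps0 * x by rewrite mulr_ge0 // ltW.
pose A (h : history n q) := if #|~: Full eps0 h|%:R <= eps0 * x then ~: Full eps0 h else finset.set0.
have cardA h : #|A h|%:R <= eps0 * x.
  by rewrite /A; case: ifP => //; rewrite cards0.
have W3 : Pr eps0 sel (crowded A T1 m k1) <= 1 / L.
  apply: le_trans (Pr_window_exp q_gt0 sel L1 Lx B0 cardA mxL _) expL.
  rewrite (_ : eps0 * x ^+ 2 * L = eps0 * x * (x * L)); last by ring.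
  apply: ler_wpM2l => //; apply: le_trans mxL.
  by rewrite ler_nat leq_subr.
have I4 := Pr_no_isolated_inv q_gt0 sel L1 Lx T2x.
have F5 := Pr_low_inv q_gt0 sel L1 Lx (isT : (0 < lazy_bound)%N) d2 (proj1 (andP kt)).
apply: le_trans (lerD W1 (lerD W2 (lerD W3 (lerD I4 F5)))) _.
rewrite le_eqVlt; apply/orP; left; apply/eqP; rewrite /fail_const.
by field; rewrite !gt_eqF.
Qed.

End Failure.

(** * Passage to the limit *)

Local Open Scope classical_set_scope.
Local Open Scope ring_scope.

Theorem theorem2 (R : realType) (q : nat) (hq : (4 <= q)%N) :
  exists eps : R, 0 < eps /\
    forall (omega : nat -> R) (sel : tie_rule q),
      omega n @[n --> \oo] --> +oo ->
      omega =o_\oo (fun n : nat => ln (ln (n%:R : R))) ->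
      valid_ties sel ->
      Pr eps sel (large_ok (n := n) eps (omega n)) @[n --> \oo] --> (1 : R).
Proof.
have q_gt0 : (0 < q)%N by apply: leq_trans hq.
exists (eps0 R q); split; first exact: eps0_gt0.
move=> omega sel omega_oo _ sel_min.
have e0 := eps0_gt0 R q; have q0 : 0 < q%:R :> R by rewrite ltr0n.
have q1 : 1 <= q%:R :> R by rewrite ler1n.
have D0 : 0 <= fail_const R q.
  apply: addr_ge0; first apply: addr_ge0.
  - exact: ler0n.
  - exact: divr_ge0 (ler0n _ _) (exprn_ge0 _ (ltW e0)).
  - apply: mulr_ge0; last exact: expR_ge0.
    exact: mulr_ge0 (ler0n _ _) (exprn_ge0 _ (divr_ge0 (ltW q0) (ltW e0))).
apply/cvgrPdist_le => e e_gt0.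
pose c := eps0 R q / (2 * q%:R).
have c0 : 0 < c by rewrite divr_gt0 // mulr_gt0.
(* A sum of nonnegative terms, so L >= C yields every lower bound on [L] at once: the first four
   terms serve the numerical hypotheses, the last makes [fail_const / L] at most [e]. *)
pose C := 1 + (2 / (eps0 R q / 32) + (800 * q%:R ^+ 2 + (expR (2 / c) + fail_const R q / e))).
have a1 : 0 <= 2 / (eps0 R q / 32) by rewrite divr_ge0 ?ler0n // divr_ge0 ?ler0n // ltW.
have a2 : 0 <= 800 * q%:R ^+ 2 :> R by apply: mulr_ge0; rewrite ?ler0n // exprn_ge0 ?ler0n.
have a3 := expR_ge0 (2 / c).
have a4 : 0 <= fail_const R q / e by rewrite divr_ge0 // ltW.
move/cvgryPge: omega_oo => /(_ 0) omega_ge0.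
near=> n.
have om0 : 0 <= omega n by near: n.
have nC : expR C <= n%:R.
  by near: n; exact: nbhs_infty_ger.
have x0 : 0 < n%:R :> R by apply: lt_le_trans nC; exact: expR_gt0.
have LC : C <= ln n%:R by rewrite -ler_expR lnK ?posrE.
have b1 : 1 <= ln n%:R :> R.
  by apply: le_trans LC; rewrite /C lerDl !addr_ge0.
have L0 : 0 < ln n%:R :> R by apply: lt_le_trans b1; exact: ltr01.
have b2 : 2 / (eps0 R q / 32) <= ln n%:R.
  apply: le_trans LC; rewrite /C; move: a1 a2 a3 a4.
  by move: (2 / _) (800 * _) (expR _) (fail_const _ _ / e) => ? ? ? ?; lra.
have b3 : 800 * q%:R ^+ 2 <= ln n%:R :> R.
  apply: le_trans LC; rewrite /C; move: a1 a2 a3 a4.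
  by move: (2 / _) (800 * _) (expR _) (fail_const _ _ / e) => ? ? ? ?; lra.
have b4 : expR (2 / c) <= ln n%:R.
  apply: le_trans LC; rewrite /C; move: a1 a2 a3 a4.
  by move: (2 / (_ / 32)) (800 * _) (expR _) (fail_const _ _ / e) => ? ? ? ?; lra.
have b5 : fail_const R q / e <= ln n%:R.
  apply: le_trans LC; rewrite /C; move: a1 a2 a3 a4.
  by move: (2 / _) (800 * _) (expR _) (fail_const _ _ / e) => ? ? ? ?; lra.
have Lx : ln n%:R <= eps0 R q / 32 * n%:R by apply: ln_le_mul => //; rewrite divr_gt0.
have lL : 2 / c <= ln (ln n%:R) by rewrite -ler_expR [leRHS]lnK ?posrE.
have lL0 : 0 <= ln (ln (n%:R : R)) by apply: le_trans lL; rewrite divr_ge0 // ltW.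
have LL : (q%:R - 1) * ln (ln n%:R) <= eps0 R q / 2 * ln n%:R.
  have h := ln_le_mul L0 c0 lL.
  apply: (@le_trans _ _ (q%:R * (c * ln n%:R))).
    apply: ler_pM => //; first by rewrite subr_ge0.
    by rewrite lerBlDr lerDl ler01.
  rewrite le_eqVlt; apply/orP; left; apply/eqP; rewrite /c; field.
  by rewrite gt_eqF.
rewrite (Pr_complement _ _ _ q_gt0) opprB addrCA subrr addr0.
rewrite ger0_norm; last by apply: sumr_ge0 => w _; exact: weight_ge0.
apply: le_trans (Pr_not_large_ok_inv q_gt0 sel_min b1 Lx b3 LL om0) _.
by rewrite ler_pdivrMr // mulrC -ler_pdivrMr.
Unshelve. all: by end_near.
Qed.
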